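(* Let $G$ be a finitely generated group. Then: (a) For all sufficiently large $n\in\mathbb{N}$, the derived subgroup $[G,G]$ embeds into a $2$-generated subgroup $H$ of the wreath product $G\wr C_n$, where $C_n$ is the cyclic group of order $n$; moreover $H$ contains the derived subgroup $[G^n,G^n]=[G,G]^n$ of the base group $G^n$ of the wreath product. (b) If $G$ is a torsion group, then $G$ embeds into a $2$-generated subgroup $H$ of a group $L$ which is an extension of a finite direct power $G^n$ (for some $n\in\mathbb{N}$) by a finite metabelian group (that is, $L$ has a normal subgroup isomorphic to $G^n$ with finite metabelian quotient). (c) If $G$ has Kazhdan's property (T), then the subgroup $H$ in (a) and in (b) has property (T). *)

(* Defs.v *)
From mathcomp Require Import all_boot all_algebra.
From Stdlib Require Import Reals FunctionalExtensionality List.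
From Coquelicot Require Complex.

Set Implicit Arguments.
Unset Strict Implicit.
Unset Printing Implicit Defensive.

Import GRing.Theory.

Record AbsGroup := MkGroup {
  gcar :> Type;
  gmul : gcar -> gcar -> gcar;
  ginv : gcar -> gcar;
  gone : gcar;
  gmulA : forall x y z, gmul x (gmul y z) = gmul (gmul x y) z;
  gmul1g : forall x, gmul gone x = x;
  gmulVg : forall x, gmul (ginv x) x = gone
}.

Arguments gmul {_}.
Arguments ginv {_}.
Arguments gone {_}.

Inductive gen (G : AbsGroup) (S : G -> Prop) : G -> Prop :=
| gen_base x : S x -> gen S x
| gen_one : gen S gone
| gen_mul x y : gen S x -> gen S y -> gen S (gmul x y)
| gen_inv x : gen S x -> gen S (ginv x).

Definition allG (G : AbsGroup) : G -> Prop := fun _ => True.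

Definition finitely_generated (G : AbsGroup) : Prop :=
  exists l : list G, forall g : G, gen (fun x => In x l) g.

Fixpoint gpow (G : AbsGroup) (g : G) (k : nat) : G :=
  match k with O => gone | S k => gmul g (gpow g k) end.

Definition torsion (G : AbsGroup) : Prop :=
  forall g : G, exists k, (0 < k)%coq_nat /\ gpow g k = gone.

Definition commg (G : AbsGroup) (x y : G) : G :=
  gmul (gmul (ginv x) (ginv y)) (gmul x y).

Definition derived (G : AbsGroup) (K : G -> Prop) : G -> Prop :=
  gen (fun z => exists x y, K x /\ K y /\ z = commg x y).

Definition two_generated (K : AbsGroup) (H : K -> Prop) : Prop :=
  exists a b : K, forall z, H z <-> gen (fun x => x = a \/ x = b) z.

Definition embeds_into (G : AbsGroup) (A : G -> Prop) (K : AbsGroup) (B : K -> Prop) :=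
  exists phi : G -> K,
    (forall x y, A x -> A y -> phi (gmul x y) = gmul (phi x) (phi y)) /\
    (forall x y, A x -> A y -> phi x = phi y -> x = y) /\
    (forall x, A x -> B (phi x)).

Section Constructions.
Variable G : AbsGroup.

Lemma gmulgV (x : G) : gmul x (ginv x) = gone.
Proof.
rewrite -[gmul x (ginv x)]gmul1g -{1}(gmulVg (ginv x)).
rewrite -gmulA (gmulA (ginv x)) gmulVg gmul1g.
exact: gmulVg.
Qed.

Lemma gmulg1 (x : G) : gmul x gone = x.
Proof. by rewrite -(gmulVg x) gmulA gmulgV gmul1g. Qed.

Definition DirectPower (n : nat) : AbsGroup.
Proof.
refine (@MkGroup ('I_n -> G) (fun f g i => gmul (f i) (g i))
          (fun f i => ginv (f i)) (fun _ => gone) _ _ _).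
- by move=> x y z; apply: functional_extensionality => i; rewrite gmulA.
- by move=> x; apply: functional_extensionality => i; rewrite gmul1g.
- by move=> x; apply: functional_extensionality => i; rewrite gmulVg.
Defined.

(* G wr C_n, C_n realised as 'Z_n (meaningful for n >= 2); elements are
   pairs (f, a), f : 'Z_n -> G in the base group, a in C_n, with
   (f, a) (g, b) = (i |-> f i * g (i - a), a + b). *)
Definition wr_mul (n : nat) (u v : ('Z_n -> G) * 'Z_n) : ('Z_n -> G) * 'Z_n :=
  (fun i => gmul (u.1 i) (v.1 (GRing.add i (GRing.opp u.2))), GRing.add u.2 v.2).
Definition wr_inv (n : nat) (u : ('Z_n -> G) * 'Z_n) : ('Z_n -> G) * 'Z_n :=
  (fun i => ginv (u.1 (GRing.add i u.2)), GRing.opp u.2).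

Definition Wreath (n : nat) : AbsGroup.
Proof.
refine (@MkGroup (('Z_n -> G) * 'Z_n) (@wr_mul n) (@wr_inv n)
          (fun _ => gone, GRing.zero) _ _ _).
- move=> [f a] [g b] [h c]; rewrite /wr_mul /=; congr pair; last by rewrite addrA.
  apply: functional_extensionality => i; rewrite gmulA.
  by rewrite opprD addrA.
- move=> [f a]; rewrite /wr_mul /=; congr pair; last by rewrite add0r.
  by apply: functional_extensionality => i; rewrite gmul1g subr0.
- move=> [f a]; rewrite /wr_mul /wr_inv /=; congr pair; last by rewrite addNr.
  by apply: functional_extensionality => i; rewrite opprK gmulVg.
Defined.

Definition wr_base (n : nat) : Wreath n -> Prop := fun w => w.2 = GRing.zero.

End Constructions.

Definition ext_power_by_fin_metabelian (G : AbsGroup) (n : nat) (L : AbsGroup)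
    (N : L -> Prop) : Prop :=
  (exists psi : DirectPower G n -> L,
     (forall x y, psi (gmul x y) = gmul (psi x) (psi y)) /\
     (forall x y, psi x = psi y -> x = y) /\
     (forall z, N z <-> exists x, z = psi x)) /\
  (forall (l x : L), N x -> N (gmul (gmul (ginv l) x) l)) /\
  (exists T : list L, forall x : L, exists t, In t T /\ N (gmul (ginv t) x)) /\
  (forall x : L, derived (derived (@allG L)) x -> N x).

Local Open Scope R_scope.

Record Hilbert := MkHilbert {
  hcar :> Type;
  h0 : hcar;
  hadd : hcar -> hcar -> hcar;
  hopp : hcar -> hcar;
  hscal : Complex.C -> hcar -> hcar;
  hinner : hcar -> hcar -> Complex.C;
  haddA : forall x y z, hadd x (hadd y z) = hadd (hadd x y) z;
  haddC : forall x y, hadd x y = hadd y x;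
  hadd0 : forall x, hadd x h0 = x;
  haddN : forall x, hadd x (hopp x) = h0;
  hscalA : forall a b x, hscal a (hscal b x) = hscal (Complex.Cmult a b) x;
  hscal1 : forall x, hscal (Complex.RtoC 1) x = x;
  hscalDl : forall a b x, hscal (Complex.Cplus a b) x = hadd (hscal a x) (hscal b x);
  hscalDr : forall a x y, hscal a (hadd x y) = hadd (hscal a x) (hscal a y);
  hinner_sym : forall x y, hinner x y = Complex.Cconj (hinner y x);
  hinner_addl : forall x y z,
      hinner (hadd x y) z = Complex.Cplus (hinner x z) (hinner y z);
  hinner_scall : forall a x y, hinner (hscal a x) y = Complex.Cmult a (hinner x y);
  hinner_pos : forall x, 0 <= Complex.Re (hinner x x);
  hinner_def : forall x, hinner x x = Complex.RtoC 0 -> x = h0;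
  hcomplete : forall u : nat -> hcar,
      (forall eps, 0 < eps -> exists N, forall m k, (N <= m)%coq_nat -> (N <= k)%coq_nat ->
          sqrt (Complex.Re (hinner (hadd (u m) (hopp (u k))) (hadd (u m) (hopp (u k))))) < eps) ->
      exists l, forall eps, 0 < eps -> exists N, forall m, (N <= m)%coq_nat ->
          sqrt (Complex.Re (hinner (hadd (u m) (hopp l)) (hadd (u m) (hopp l)))) < eps
}.

Arguments h0 {h}.
Arguments hadd {h}.
Arguments hopp {h}.
Arguments hscal {h}.
Arguments hinner {h}.

Definition hnorm (V : Hilbert) (x : V) : R := sqrt (Complex.Re (hinner x x)).

Definition unitary_op (V : Hilbert) (U : V -> V) : Prop :=
  (forall x y, U (hadd x y) = hadd (U x) (U y)) /\
  (forall a x, U (hscal a x) = hscal a (U x)) /\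
  (forall y, exists x, U x = y) /\
  (forall x y, hinner (U x) (U y) = hinner x y).

Definition unitary_rep (K : AbsGroup) (H : K -> Prop) (V : Hilbert) (pi : K -> V -> V) :=
  (forall g, H g -> unitary_op (pi g)) /\
  (forall g h, H g -> H h -> forall v, pi (gmul g h) v = pi g (pi h v)) /\
  (forall v, pi gone v = v).

Definition property_T (K : AbsGroup) (H : K -> Prop) : Prop :=
  forall (V : Hilbert) (pi : K -> V -> V), unitary_rep H pi ->
    (forall (Q : list K) (eps : R), (forall g, In g Q -> H g) -> 0 < eps ->
       exists v : V, hnorm v = 1 /\
         forall g, In g Q -> hnorm (hadd (pi g v) (hopp v)) < eps) ->
    exists v : V, v <> h0 /\ forall g, H g -> pi g v = v.

(* Main.v *)
(** For (a), put the [i]-th generator of [G] at position [2 ^ i] of an element [b] of the base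
    group and let [H] be generated by [b] and the shift. Powers of two form a Sidon set, so two
    distinct shifts of [b] overlap in at most one coordinate; hence the commutator of two suitable
    shifts is concentrated at [0], with value the commutator of two generators, and [H] contains
    [[G, G]] in every coordinate.

    For (c), a finitely generated group with (T) has no nonzero homomorphism to the reals (the
    diagonal representation on l2 with phases [chi / (n + 1)] has almost invariant vectors but no
    invariant one), so [[G, G]] has finite index, and it inherits (T) by inducing representations.
    A group in which commuting copies of a group with (T) generate a subgroup of finite index has
    (T): almost invariant vectors are close to vectors fixed by all the copies, and averaging these
    over a transversal produces an invariant vector.

    For (b), a finitely generated torsion group has no nonzero homomorphism to the reals either, so
    [G / [G, G]] has some exponent [M]; the diagonal of [G wr C_p] with [p = 2 M] then lies in the
    derived subgroup of [G wr C_p], and (a) applies to [G wr C_p]. *)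
From Pilot Require Import Defs.
From mathcomp Require Import all_boot all_algebra.
From Stdlib Require Import Reals List.
From HB Require Import structures.
From Stdlib Require Import Lra Lia ClassicalEpsilon ProofIrrelevance FunctionalExtensionality.
From Coquelicot Require Import Coquelicot.
From mathcomp Require Import zify.
Import Pilot.Defs GRing.Theory.
Delimit Scope nat_scope with N.
Local Open Scope nat_scope.

(** * Groups and homomorphisms to the reals *)

Section Groups.
Context {G : AbsGroup}.
Implicit Types (x y z : G) (P S : G -> Prop).

Lemma gmulrA x y z : gmul (gmul x y) z = gmul x (gmul y z).
Proof. by rewrite gmulA. Qed.

Lemma gmulKg x y : gmul (ginv x) (gmul x y) = y.
Proof. by rewrite gmulA gmulVg gmul1g. Qed.

Lemma gmulKVg x y : gmul x (gmul (ginv x) y) = y.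
Proof. by rewrite gmulA gmulgV gmul1g. Qed.

Lemma gmul_injl x y z : gmul x y = gmul x z -> y = z.
Proof. by move=> e; rewrite -(gmulKg x y) e gmulKg. Qed.

Lemma ginv1 : ginv (gone : G) = gone.
Proof. by rewrite -[LHS]gmulg1 gmulVg. Qed.

Lemma ginvK x : ginv (ginv x) = x.
Proof. by apply: (@gmul_injl (ginv x)); rewrite gmulgV gmulVg. Qed.

Lemma ginvM x y : ginv (gmul x y) = gmul (ginv y) (ginv x).
Proof.
by apply: (@gmul_injl (gmul x y)); rewrite gmulgV gmulrA gmulKVg gmulgV.
Qed.

(* A complete rewriting system for the theory of groups: [rewrite !gE] decides
   equality of group words. *)
Definition gE := (ginvM, ginvK, ginv1, gmulrA, gmulKg, gmulKVg, @gmulgV G,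
  @gmulVg G, @gmul1g G, @gmulg1 G).

Definition subgroup P :=
  P gone /\ (forall x y, P x -> P y -> P (gmul x y)) /\ (forall x, P x -> P (ginv x)).

Lemma gen_subgroup S : subgroup (gen S).
Proof. by split; [exact: gen_one|split; [exact: gen_mul|exact: gen_inv]]. Qed.

Lemma gen_min S P x : subgroup P -> (forall y, S y -> P y) -> gen S x -> P x.
Proof.
move=> [P1 [PM PV]] SP; elim=> [y /SP|//|y z _ Py _ Pz|y _ Py] //; first exact: PM.
exact: PV.
Qed.

Lemma gpowD x m n : gpow x (m + n) = gmul (gpow x m) (gpow x n).
Proof. by elim: m => [|m IH]; rewrite ?add0n ?gmul1g // addSn /= IH gmulA. Qed.

Lemma gpowM x m n : gpow x (m * n) = gpow (gpow x m) n.
Proof. by elim: n => [|n IH]; rewrite ?muln0 // mulnS gpowD /= IH. Qed.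

Lemma gpow_sub P x n : subgroup P -> P x -> P (gpow x n).
Proof. by move=> [P1 [PM PV]] Px; elim: n => [//|n IH] /=; apply: PM. Qed.

Lemma derived_subgroup : subgroup (derived (@allG G)).
Proof. exact: gen_subgroup. Qed.

Lemma derived_comm x y : derived (@allG G) (commg x y).
Proof. by apply: gen_base; exists x, y. Qed.

(** Normality comes from [y^-1 x y = x [x, y]], whose second factor is a commutator. *)
Lemma comm_normal P x y : subgroup P -> (forall u v, P (commg u v)) ->
  P x -> P (gmul (gmul (ginv y) x) y).
Proof.
move=> [P1 [PM PV]] Pc Px.
have -> : gmul (gmul (ginv y) x) y = gmul x (commg x y).
  by rewrite /commg !gE.
exact: PM.
Qed.

(** The left cosets [t P] with [t] in the list cover the group; repeated cosets are allowed, and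
    [transversal] below removes them. *)
Definition finite_index P :=
  exists T : list G, forall x, exists t, In t T /\ P (gmul (ginv t) x).

Definition bounded_exponent P :=
  exists M, (0 < M)%N /\ forall x, P (gpow x M).

Section Congruence.
Variable P : G -> Prop.
Hypothesis sP : subgroup P.
Hypothesis cP : forall x y, P (commg x y).

(** Equality in the abelian quotient by [P], expressed by a congruence so that no quotient group has
    to be built. *)
Definition cgr x y := P (gmul x (ginv y)).

Let P1 : P gone. Proof. by case: sP. Qed.
Let PM x y : P x -> P y -> P (gmul x y). Proof. by case: sP => _ [+ _]; apply. Qed.
Let PV x : P x -> P (ginv x). Proof. by case: sP => _ [_]; apply. Qed.

Lemma cgr_refl x : cgr x x. Proof. by rewrite /cgr gmulgV. Qed.

Lemma cgr_sym x y : cgr x y -> cgr y x.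
Proof. by move=> /PV; rewrite /cgr !gE. Qed.

Lemma cgr_trans y x z : cgr x y -> cgr y z -> cgr x z.
Proof. by move=> a b; have := PM _ _ a b; rewrite /cgr !gE. Qed.

Lemma cgr_mul x x' y y' : cgr x x' -> cgr y y' -> cgr (gmul x y) (gmul x' y').
Proof.
move=> a b.
have c := @comm_normal P _ (ginv x) sP cP b.
by have := PM _ _ c a; rewrite /cgr !gE.
Qed.

Lemma cgr_comm x y : cgr (gmul x y) (gmul y x).
Proof. by have := cP (ginv x) (ginv y); rewrite /cgr /commg !gE. Qed.

Lemma cgr_pow x y n : cgr x y -> cgr (gpow x n) (gpow y n).
Proof.
by move=> xy; elim: n => [|n IH] /=; [exact: cgr_refl|exact: cgr_mul].
Qed.

Lemma cgr_powM x y n : cgr (gpow (gmul x y) n) (gmul (gpow x n) (gpow y n)).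
Proof.
elim: n => [|n IH] /=; first by rewrite gmul1g; exact: cgr_refl.
apply: (cgr_trans (gmul (gmul x y) (gmul (gpow x n) (gpow y n)))).
  by apply: cgr_mul => //; exact: cgr_refl.
rewrite !gmulrA; apply: cgr_mul; first exact: cgr_refl.
rewrite !gmulA; apply: cgr_mul; last exact: cgr_refl.
exact: cgr_comm.
Qed.

Lemma cgr1 x : P x <-> cgr x gone.
Proof. by rewrite /cgr ginv1 gmulg1. Qed.

Lemma cgr_cycle a k j : (0 < k)%N -> P (gpow a k) -> cgr (gpow a j) (gpow a (j %% k)).
Proof.
move=> k0 Pk; rewrite {1}(divn_eq j k) gpowD -[X in cgr _ X]gmul1g mulnC gpowM.
apply: cgr_mul; last exact: cgr_refl.
by apply: (proj1 (cgr1 _)); exact: (gpow_sub P _ _ sP).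
Qed.

(* The subgroup generated by [P] and [a]: [x a^n = a^m] modulo [P], so that [m - n] is the
   exponent of [a]. *)
Definition has_exp a x (m n : nat) := cgr (gmul x (gpow a n)) (gpow a m).

Lemma has_exp_mul a x y m n m' n' : has_exp a x m n -> has_exp a y m' n' ->
  has_exp a (gmul x y) (m + m') (n + n').
Proof.
move=> hx hy; rewrite /has_exp !gpowD.
apply: cgr_trans (cgr_mul _ _ _ _ hx hy).
rewrite !gmulrA; apply: cgr_mul; first exact: cgr_refl.
rewrite !gmulA; apply: cgr_mul; last exact: cgr_refl.
exact: cgr_comm.
Qed.

Lemma has_exp_cgr a x y m n : cgr x y -> has_exp a y m n -> has_exp a x m n.
Proof.
move=> xy; apply: cgr_trans; apply: cgr_mul => //; exact: cgr_refl.
Qed.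

Definition adjoin a x := exists m n, has_exp a x m n.

Lemma adjoin_P a x : P x -> adjoin a x.
Proof. by move=> Px; exists 0, 0; rewrite /has_exp /cgr /= !gE. Qed.

Lemma adjoin_a a : adjoin a a.
Proof. by exists 1, 0; rewrite /has_exp /= !gmulg1; exact: cgr_refl. Qed.

Lemma adjoin_subgroup a : subgroup (adjoin a).
Proof.
split; first exact: adjoin_P.
split=> [x y [m [n hx]] [m' [n' hy]]|x [m [n hx]]].
  by exists (m + m'), (n + n'); exact: has_exp_mul.
exists n, m; have := cgr_mul _ _ _ _ (cgr_refl (ginv x)) hx.
by rewrite gmulKg => /cgr_sym.
Qed.

Lemma adjoin_torsion a k x : (0 < k)%N -> P (gpow a k) -> adjoin a x ->
  exists2 j, (j < k)%N & cgr x (gpow a j).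
Proof.
(* Multiplying [x a^n = a^m] by [a^(n (k-1))] turns the factor [a^n] into [a^(n k)], which lies in
   [P]; this isolates [x] without negative exponents. *)
move=> k0 Pk [m [n hx]]; exists ((m + n * k.-1) %% k); first by rewrite ltn_mod.
apply: cgr_trans (cgr_cycle a k _ k0 Pk); apply: cgr_sym.
apply: (cgr_trans (gmul (gmul x (gpow a n)) (gpow a (n * k.-1)))).
  rewrite gpowD; apply: cgr_mul; [exact: cgr_sym|exact: cgr_refl].
rewrite gmulrA -gpowD -mulnS prednK // mulnC gpowM -[X in cgr _ X]gmulg1.
apply: cgr_mul; first exact: cgr_refl.
by apply: (proj1 (cgr1 _)); exact: (gpow_sub P _ _ sP).
Qed.

(** Both [a^(m + n')] and [a^(m' + n)] are congruent to [x a^(n + n')]; unequal exponents would put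
    a positive power of [a] in [P]. *)
Lemma has_exp_uniq a x m n m' n' : (forall k, (0 < k)%N -> ~ P (gpow a k)) ->
  has_exp a x m n -> has_exp a x m' n' -> (m + n' = m' + n)%N.
Proof.
move=> free h h'.
have key : cgr (gpow a (m + n')) (gpow a (m' + n)).
  rewrite !gpowD; apply: (cgr_trans (gmul (gmul x (gpow a n)) (gpow a n'))).
    by apply: cgr_mul; [exact: cgr_sym|exact: cgr_refl].
  apply: (@cgr_trans (gmul (gmul x (gpow a n')) (gpow a n))).
    by rewrite !gmulrA -!gpowD addnC; exact: cgr_refl.
  by apply: cgr_mul => //; exact: cgr_refl.
have aux p q : cgr (gpow a (p + q)) (gpow a q) -> p = 0.
  case: p => // p; rewrite /cgr gpowD gmulrA gmulgV gmulg1 => /free; case=> //.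
case: (leqP (m + n') (m' + n)) => le.
  move: (cgr_sym _ _ key); rewrite -{1}(subnK le) => /aux/eqP; rewrite subn_eq0 => ge.
  by apply/eqP; rewrite eqn_leq le ge.
by move: key; rewrite -{1}(subnK (ltnW le)) => /aux/eqP; rewrite subn_eq0 leqNgt le.
Qed.

End Congruence.
End Groups.

(** * Finite abelianization or a nonzero real character *)

Section Dichotomy.
Variable G : AbsGroup.

Definition real_char (chi : G -> R) :=
  (forall x y, chi (gmul x y) = (chi x + chi y)%R) /\ exists g, chi g <> 0%R.

(** The character sends [x] to the exponent of [a] in [x^M] modulo [P]. It is additive since
    [(x y)^M] and [x^M y^M] are congruent, and its value at [a] is [M], which is positive. *)
Lemma real_char_adjoin (P : G -> Prop) (a : G) : subgroup P ->
  (forall x y, P (commg x y)) -> bounded_exponent (adjoin P a) ->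
  (forall k, (0 < k)%N -> ~ P (gpow a k)) -> exists chi, real_char chi.
Proof.
move=> sP cP [M [M0 hM]] free.
have ex x : exists mn : nat * nat, has_exp P a (gpow x M) mn.1 mn.2.
  by have [m [n h]] := hM x; exists (m, n).
pose e x := proj1_sig (constructive_indefinite_description _ (ex x)).
have eP x : has_exp P a (gpow x M) (e x).1 (e x).2.
  exact: (proj2_sig (constructive_indefinite_description _ (ex x))).
exists (fun x => (INR (e x).1 - INR (e x).2)%R); split.
  move=> x y.
  have := @has_exp_mul _ P sP cP _ _ _ _ _ _ _ (eP x) (eP y).
  move/(@has_exp_cgr _ P sP cP _ _ _ _ _ (cgr_powM P sP cP x y M)).
  move/(has_exp_uniq P sP cP a _ _ _ _ _ free)/(_ (eP (gmul x y))).
  move/(f_equal INR); rewrite !plus_INR. lra.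
exists a.
have h : has_exp P a (gpow a M) M 0.
  by rewrite /has_exp /= gmulg1; exact: cgr_refl.
have := has_exp_uniq P sP cP a _ _ _ _ _ free h (eP a).
move/(f_equal INR); rewrite -!plusE !plus_INR /=.
have : (0 < INR M)%R by apply: lt_0_INR; apply/ltP.
lra.
Qed.

(** Induction on the generators still missing from [P], adjoining one at a time. If a positive power
    of the new generator [a] lies in [P], finiteness descends from [adjoin P a] to [P]; otherwise
    [a] yields a character. The bounded exponent is carried along because [real_char_adjoin] needs
    it. *)
Lemma finite_or_real_char_rel (l : list G) (P : G -> Prop) : subgroup P ->
  (forall x y, P (commg x y)) ->
  (forall x, gen (fun y => P y \/ In y l) x) ->
  (finite_index P /\ bounded_exponent P) \/ exists chi, real_char chi.
Proof.
elim: l P => [|a l IH] P sP cP hgen.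
  have allP x : P x by apply: gen_min (hgen x) => // y [].
  left; split; first by exists (cons gone nil) => x; exists gone; split=> //; left.
  by exists 1.
have sA := adjoin_subgroup P sP cP a.
have cA x y : adjoin P a (commg x y) by apply: adjoin_P.
case: (IH _ sA cA) => [x|[[T hT] bA]|]; last by right.
  apply: gen_min (hgen x) => [|y]; first exact: gen_subgroup.
  case=> [Py|[<-|yl]]; apply: gen_base; [left|left|by right].
    exact: adjoin_P.
  exact: adjoin_a.
case: (excluded_middle_informative (exists k, (0 < k)%N /\ P (gpow a k))) => [|nk].
  case=> k [k0 Pk]; left; split.
    exists (List.flat_map (fun t => List.map (fun j => gmul t (gpow a j)) (List.seq 0 k)) T).
    move=> x; have [t [tT /(adjoin_torsion P sP cP _ k _ k0 Pk) [j jk cj]]] := hT x.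
    exists (gmul t (gpow a j)); split.
      apply/in_flat_map; exists t; split=> //; apply/in_map_iff; exists j; split=> //.
      by apply/in_seq; split; [exact: Nat.le_0_l|apply/ltP].
    have := @comm_normal _ P _ (gpow a j) sP cP cj.
    by rewrite !gE.
  (* Modulo [P], [x^M] is a power of [a], and the [k]-th power of any power of [a] lies in [P]. *)
  case: bA => M [M0 hM]; exists (M * k); split; first by rewrite muln_gt0 M0.
  move=> x; rewrite gpowM.
  have [j jk cj] := adjoin_torsion P sP cP _ k _ k0 Pk (hM x).
  apply: (proj2 (cgr1 P _)); apply: (cgr_trans P sP (gpow (gpow a j) k)).
    exact: cgr_pow.
  by rewrite -gpowM mulnC gpowM; apply: (proj1 (cgr1 P _)); exact: gpow_sub.
right; apply: (@real_char_adjoin P a) => // k k0 Pk; apply: nk; by exists k.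
Qed.

Lemma finite_or_real_char : finitely_generated G ->
  (finite_index (derived (@allG G)) /\ bounded_exponent (derived (@allG G))) \/
  exists chi, real_char chi.
Proof.
case=> l hl; apply: (@finite_or_real_char_rel l).
- exact: derived_subgroup.
- exact: derived_comm.
move=> x; apply: gen_min (hl x); first exact: gen_subgroup.
by move=> y yl; apply: gen_base; right.
Qed.

Lemma torsion_real_char chi : torsion G -> ~ real_char chi.
Proof.
move=> tG [hom [g ng]]; have [k [k0 gk]] := tG g.
have chi1 : chi gone = 0%R by have := hom gone gone; rewrite gmul1g; lra.
have pw n : chi (gpow g n) = (INR n * chi g)%R.
  elim: n => [|n IH]; first by rewrite /= chi1; lra.
  by rewrite S_INR /= hom IH; lra.
have := pw k; rewrite gk chi1 => /esym/Rmult_integral [] // h.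
by have := lt_0_INR _ k0; lra.
Qed.

End Dichotomy.

Local Open Scope R_scope.

(** * Hilbert spaces *)

Lemma choice_fun (A B : Type) (P : A -> B -> Prop) :
  (forall x, exists y, P x y) -> exists f, forall x, P x (f x).
Proof.
move=> h; exists (fun x => proj1_sig (constructive_indefinite_description _ (h x))).
by move=> x; exact: (proj2_sig (constructive_indefinite_description _ (h x))).
Qed.

Lemma lt_eps_le (x y : R) : (forall eps, 0 < eps -> x < y + eps) -> x <= y.
Proof. by move=> h; apply: Rnot_lt_le => xy; have := h (x - y); lra. Qed.

Section HilbertBasics.
Context {V : Hilbert}.
Implicit Types (x y z v w : V) (W : V -> Prop).

(** A real inner product with the same norm, so that all estimates become real inequalities. *)
Definition rin x y := Re (hinner x y).
Definition hsub x y := hadd x (hopp y).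

Lemma rin_sym x y : rin x y = rin y x.
Proof. by rewrite /rin hinner_sym. Qed.

Lemma rinDl x y z : rin (hadd x y) z = rin x z + rin y z.
Proof. by rewrite /rin hinner_addl. Qed.

Lemma rinZl (r : R) x y : rin (hscal (RtoC r) x) y = r * rin x y.
Proof. by rewrite /rin hinner_scall /Re /=; ring. Qed.

Lemma rin0l y : rin h0 y = 0.
Proof. by have := rinDl h0 h0 y; rewrite hadd0; lra. Qed.

Lemma rinNl x y : rin (hopp x) y = - rin x y.
Proof. by have := rinDl x (hopp x) y; rewrite haddN rin0l; lra. Qed.

Lemma rinBl x y z : rin (hsub x y) z = rin x z - rin y z.
Proof. by rewrite rinDl rinNl. Qed.

Definition rinlE := (rinBl, rinDl, rinNl, rinZl, rin0l).

Lemma rinDr x y z : rin z (hadd x y) = rin z x + rin z y.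
Proof. by rewrite !(rin_sym z) rinDl. Qed.

Lemma rinZr (r : R) x y : rin y (hscal (RtoC r) x) = r * rin y x.
Proof. by rewrite !(rin_sym y) rinZl. Qed.

Lemma rin0r y : rin y h0 = 0.
Proof. by rewrite rin_sym rin0l. Qed.

Lemma rinNr x y : rin y (hopp x) = - rin y x.
Proof. by rewrite !(rin_sym y) rinNl. Qed.

Lemma rinBr x y z : rin z (hsub x y) = rin z x - rin z y.
Proof. by rewrite rinDr rinNr. Qed.

Definition rinE := (rinBl, rinDl, rinNl, rinZl, rin0l, rinBr, rinDr, rinNr, rinZr, rin0r).

Lemma rin_ge0 x : 0 <= rin x x. Proof. exact: hinner_pos. Qed.

Lemma hinner_self x : hinner x x = RtoC (rin x x).
Proof.
have := hinner_sym x x; rewrite /rin; case: (hinner x x) => a b [] h.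
by rewrite /RtoC /=; congr pair; lra.
Qed.

Lemma rin_eq0 x : rin x x = 0 -> x = h0.
Proof. by move=> h; apply: hinner_def; rewrite hinner_self h. Qed.

Lemma hsub_eq0 x y : hsub x y = h0 -> x = y.
Proof.
move=> h; have : hadd (hsub x y) y = hadd h0 y by rewrite h.
by rewrite /hsub -haddA (haddC (hopp y)) haddN (haddC h0) !hadd0.
Qed.

Lemma rin_ext x y : (forall z, rin x z = rin y z) -> x = y.
Proof. by move=> h; apply: hsub_eq0; apply: rin_eq0; rewrite rinBl h; ring. Qed.

Lemma hoppE x : hopp x = hscal (RtoC (-1)) x.
Proof. by apply: rin_ext => z; rewrite !rinlE; ring. Qed.

Lemma hnorm_ge0 x : 0 <= hnorm x. Proof. exact: sqrt_pos. Qed.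

Lemma hnorm_sqr x : hnorm x * hnorm x = rin x x.
Proof. exact: sqrt_sqrt (rin_ge0 x). Qed.

Lemma hnorm_eq0 x : hnorm x = 0 -> x = h0.
Proof. by move=> h; apply: rin_eq0; rewrite -hnorm_sqr h; ring. Qed.

Lemma hnorm0 : hnorm (h0 : V) = 0.
Proof.
have := hnorm_sqr h0; rewrite rin0l => /Rmult_integral; tauto.
Qed.

Lemma hnorm_gt0 x : x <> h0 -> 0 < hnorm x.
Proof.
by move=> h; case: (hnorm_ge0 x) => // /esym /hnorm_eq0.
Qed.

Lemma hnorm_le_sqr x (r : R) : 0 <= r -> rin x x <= r * r -> hnorm x <= r.
Proof. by move=> r0; rewrite -hnorm_sqr => h; have := hnorm_ge0 x; nra. Qed.

Lemma hnorm_lt_sqr x (r : R) : 0 <= r -> rin x x < r * r -> hnorm x < r.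
Proof. by move=> r0; rewrite -hnorm_sqr => h; have := hnorm_ge0 x; nra. Qed.

Lemma hnorm_eq_sqr x y : rin x x = rin y y -> hnorm x = hnorm y.
Proof. by rewrite /hnorm -!/(rin _ _) => ->. Qed.

(** Expand the squared norm of [|y| x - |x| y], which is nonnegative, and cancel [|x| |y|]; vectors
    of norm zero are treated apart. *)
Lemma cauchy_schwarz x y : rin x y <= hnorm x * hnorm y.
Proof.
have X := hnorm_ge0 x; have Y := hnorm_ge0 y.
have [x0|xp] := Req_dec (hnorm x) 0.
  by rewrite x0 (hnorm_eq0 _ x0) rin0l; lra.
have := rin_ge0 (hsub (hscal (RtoC (hnorm y)) x) (hscal (RtoC (hnorm x)) y)).
rewrite !rinE (rin_sym y x) -!hnorm_sqr => h.
have [y0|yp] := Req_dec (hnorm y) 0.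
  by rewrite y0 (hnorm_eq0 _ y0) rin0r; lra.
have : 0 < hnorm x * hnorm y by nra.
nra.
Qed.

Lemma hnormD x y : hnorm (hadd x y) <= hnorm x + hnorm y.
Proof.
have X := hnorm_ge0 x; have Y := hnorm_ge0 y; apply: hnorm_le_sqr; first lra.
rewrite !rinE (rin_sym y x) -!hnorm_sqr; have := cauchy_schwarz x y; nra.
Qed.

Lemma hsub_trans x y z : hnorm (hsub x z) <= hnorm (hsub x y) + hnorm (hsub y z).
Proof.
apply: Rle_trans (hnormD _ _); right; congr hnorm.
by apply: rin_ext => u; rewrite !rinlE; ring.
Qed.

Lemma hsub_sym x y : hnorm (hsub x y) = hnorm (hsub y x).
Proof. by apply: hnorm_eq_sqr; rewrite !rinE; ring. Qed.

Lemma hsubxx x : hsub x x = h0. Proof. exact: haddN. Qed.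

Lemma hnormZ (r : R) x : 0 <= r -> hnorm (hscal (RtoC r) x) = r * hnorm x.
Proof.
move=> r0; have := hnorm_sqr (hscal (RtoC r) x); rewrite !rinE -hnorm_sqr.
have := hnorm_ge0 (hscal (RtoC r) x); have := hnorm_ge0 x => *.
by apply: Rsqr_inj; rewrite /Rsqr; nra.
Qed.

Lemma hnormB_ge x y : hnorm x - hnorm y <= hnorm (hsub x y).
Proof.
have := hnormD (hsub x y) y.
have -> : hadd (hsub x y) y = x by apply: rin_ext => z; rewrite !rinlE; ring.
lra.
Qed.

Definition hclosed W :=
  forall l, (forall eps, 0 < eps -> exists w, W w /\ hnorm (hsub w l) < eps) -> W l.

Definition subspace W :=
  W h0 /\ (forall x y, W x -> W y -> W (hadd x y)) /\
  (forall a x, W x -> W (hscal a x)) /\ hclosed W.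

Lemma subspaceB W x y : subspace W -> W x -> W y -> W (hsub x y).
Proof.
move=> [_ [WD [WZ _]]] Wx Wy; rewrite /hsub hoppE; apply: WD => //; exact: WZ.
Qed.

(** For a complex subspace this is the usual orthogonality: replacing [w] by [i w] controls the
    imaginary part as well. *)
Definition perp W x := forall w, W w -> rin x w = 0.

Lemma rin_scal_conj (a : C) x y : rin (hscal a x) y = rin x (hscal (Cconj a) y).
Proof.
rewrite (rin_sym x) /rin !hinner_scall (hinner_sym y x).
by case: (hinner x y) => u v; case: a => b c; rewrite /Re /=; ring.
Qed.

Lemma perp_subspace W : subspace W -> subspace (perp W).
Proof.
move=> [W0 [WD [WZ _]]]; split; first by move=> w _; rewrite rin0l.
split; first by move=> x y hx hy w Ww; rewrite rinDl hx // hy //; ring.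
split; first by move=> a x hx w Ww; rewrite rin_scal_conj hx //; exact: WZ.
move=> l hl w Ww; have N := hnorm_ge0 w.
have bound eps : 0 < eps -> Rabs (rin l w) <= 0 + eps * (hnorm w + 1).
  move=> e0; have [x [hx hxl]] := hl _ e0.
  have -> : rin l w = rin (hsub l x) w by rewrite rinBl hx //; ring.
  rewrite hsub_sym in hxl.
  have c1 := cauchy_schwarz (hsub l x) w.
  have c2 := cauchy_schwarz (hsub x l) w.
  have c3 : rin (hsub x l) w = - rin (hsub l x) w by rewrite !rinlE; ring.
  rewrite (hsub_sym x l) c3 in c2.
  have : hnorm (hsub l x) * hnorm w <= eps * hnorm w by apply: Rmult_le_compat_r; lra.
  by move=> c4; apply: Rabs_le; split; lra.
have : Rabs (rin l w) <= 0.
  apply: lt_eps_le => eps e0.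
  have := bound (eps / (2 * (hnorm w + 1))).
  have -> : eps / (2 * (hnorm w + 1)) * (hnorm w + 1) = eps / 2 by field; lra.
  have p0 : 0 < eps / (2 * (hnorm w + 1)) by apply: Rdiv_lt_0_compat; lra.
  by move/(_ p0); lra.
by move/Rabs_le_between; lra.
Qed.

Lemma inf_dist W x : W h0 -> exists d, (forall w, W w -> d <= hnorm (hsub x w)) /\
  forall eps, 0 < eps -> exists w, W w /\ hnorm (hsub x w) < d + eps.
Proof.
move=> W0.
(* [completeness] provides suprema, so the infimum is taken through negated distances. *)
have [||m [ub lb]] := completeness (fun r => exists w, W w /\ r = - hnorm (hsub x w)).
- by exists 0 => r [w [_ ->]]; have := hnorm_ge0 (hsub x w); lra.
- by exists (- hnorm (hsub x h0)), h0.
exists (- m); split=> [w Ww|eps e0].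
  have : - hnorm (hsub x w) <= m by apply: ub; exists w.
  lra.
apply: NNPP => nex.
have : m <= m - eps; last lra.
apply: lb => r [w [Ww ->]]; apply: Rnot_lt_le => h; apply: nex; exists w; split=> //; lra.
Qed.

Lemma parallelogram x u w : rin (hsub u w) (hsub u w) =
  2 * rin (hsub x u) (hsub x u) + 2 * rin (hsub x w) (hsub x w)
  - 4 * rin (hsub x (hscal (RtoC (/2)) (hadd u w))) (hsub x (hscal (RtoC (/2)) (hadd u w))).
Proof. by rewrite !rinE (rin_sym w u) (rin_sym w x) (rin_sym u x); field. Qed.

(** A minimising sequence is Cauchy by the parallelogram law, because the midpoints stay in [W] and
    so at distance at least [d] from [x]. Its limit lies in [W] by closedness. *)
Lemma nearest_point W x : subspace W ->
  exists p, W p /\ forall w, W w -> hnorm (hsub x p) <= hnorm (hsub x w).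
Proof.
move=> [W0 [WD [WZ Wc]]].
have [d [dle dinf]] := inf_dist W x W0.
have d0 : 0 <= d.
  apply: Rnot_lt_le => h; have [w [_]] := dinf (- d) ltac:(lra).
  by have := hnorm_ge0 (hsub x w); lra.
have [u hu] := @choice_fun nat V (fun n w => W w /\ hnorm (hsub x w) < d + / (INR n + 1))
  (fun n => dinf _ (RinvN_pos n)).
have small eps : 0 < eps -> exists N, forall n, (N <= n)%coq_nat -> / (INR n + 1) < eps.
  move=> e0; have [N [hN N0]] := archimed_cor1 _ e0.
  exists N => n /le_INR hn; apply: Rlt_trans hN.
  by apply: Rinv_lt_contravar; have := lt_0_INR _ N0; nra.
have mid n m : d <= hnorm (hsub x (hscal (RtoC (/2)) (hadd (u n) (u m)))).
  by apply: dle; apply: WZ; apply: WD; case: (hu n); case: (hu m).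
(* The bound is [4 (d + eta)^2 - 4 d^2]; for [eta <= 1] it is at most [(8 d + 4) eta], which
   explains the choice of [eta] below. *)
have cauchy n m eta : 0 <= eta -> / (INR n + 1) < eta -> / (INR m + 1) < eta ->
    hnorm (hsub (u n) (u m)) * hnorm (hsub (u n) (u m)) <= 8 * d * eta + 4 * eta * eta.
  move=> e0 hn hm; rewrite hnorm_sqr (parallelogram x) -!hnorm_sqr.
  have [_ un] := hu n; have [_ um] := hu m.
  have := mid n m; have := hnorm_ge0 (hsub x (u n)); have := hnorm_ge0 (hsub x (u m)).
  by nra.
have [l hl] : exists l, forall eps, 0 < eps -> exists N, forall m, (N <= m)%coq_nat ->
    hnorm (hsub (u m) l) < eps.
  apply: hcomplete => eps e0.
  have q0 : 0 < 8 * d + 4 by lra.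
  have [eta [eta0 [eta1 heta]]] : exists eta, 0 < eta /\ eta <= 1 /\
      (8 * d + 4) * eta < eps * eps.
    exists (Rmin 1 (eps * eps / (2 * (8 * d + 4)))).
    have h : 0 < eps * eps / (2 * (8 * d + 4)) by apply: Rdiv_lt_0_compat; nra.
    split; first by apply: Rmin_pos; lra.
    split; first exact: Rmin_l.
    apply: (Rle_lt_trans _ ((8 * d + 4) * (eps * eps / (2 * (8 * d + 4))))).
      by apply: Rmult_le_compat_l; [lra|exact: Rmin_r].
    have -> : (8 * d + 4) * (eps * eps / (2 * (8 * d + 4))) = eps * eps / 2 by field; lra.
    nra.
  have [N hN] := small _ eta0; exists N => m k mN kN.
  have := cauchy m k eta (Rlt_le _ _ eta0) (hN _ mN) (hN _ kN).
  have := hnorm_ge0 (hsub (u m) (u k)); rewrite -/(hsub _ _) -/(hnorm _) => *.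
  by nra.
have Wl : W l.
  apply: Wc => eps e0; have [N hN] := hl _ e0; exists (u N); split; first by case: (hu N).
  exact: hN.
exists l; split=> // w Ww; apply: (Rle_trans _ d); last exact: dle.
apply: lt_eps_le => eps e0.
have [N hN] := hl (eps / 2) ltac:(lra); have [M hM] := small (eps / 2) ltac:(lra).
have a := hN (N + M)%coq_nat (Nat.le_add_r _ _).
have b := hM (N + M)%coq_nat (Nat.le_add_l _ _).
have [_ c] := hu (N + M)%coq_nat.
by have := hsub_trans x (u (N + M)%coq_nat) l; lra.
Qed.

(** At the nearest point [p], moving to [p + t w] cannot decrease the distance, so a quadratic in
    [t] without constant term is nonnegative and its linear coefficient vanishes. *)
Lemma projection W x : subspace W -> exists p, W p /\ perp W (hsub x p).
Proof.
move=> sW; have [p [Wp hp]] := nearest_point W x sW; exists p; split=> // w Ww.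
have [_ [WD [WZ _]]] := sW.
have key t : 0 <= t * t * rin w w - 2 * t * rin (hsub x p) w.
  have := hp _ (WD _ _ Wp (WZ (RtoC t) _ Ww)).
  have := hnorm_ge0 (hsub x p) => a b.
  have : rin (hsub x p) (hsub x p) <=
      rin (hsub x (hadd p (hscal (RtoC t) w))) (hsub x (hadd p (hscal (RtoC t) w))).
    by rewrite -!hnorm_sqr; nra.
  by rewrite !rinE (rin_sym w x) (rin_sym p x) (rin_sym w p); lra.
set b := rin (hsub x p) w in key *.
have [w0|w0] := Req_dec (rin w w) 0.
  by have := key 1; have := key (-1); rewrite w0; lra.
(* The minimiser of the quadratic, where its value is [- b^2 / |w|^2]. *)
have := key (b / rin w w).
have -> : b / rin w w * (b / rin w w) * rin w w - 2 * (b / rin w w) * b = - (b * b / rin w w).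
  by field.
have wp : 0 < rin w w by have := rin_ge0 w; lra.
move=> h; have : b * b <= 0.
  have -> : b * b = b * b / rin w w * rin w w by field.
  nra.
by nra.
Qed.

Lemma perp_self W x : W x -> perp W x -> x = h0.
Proof. by move=> Wx hx; apply: rin_eq0; exact: hx. Qed.

(** The errors [x - p] and [y - q] are orthogonal to [p - q], hence [|p - q|^2 = <x - y, p - q>] and
    Cauchy-Schwarz applies. *)
Lemma projection_le W x y p q : subspace W -> W p -> W q ->
  perp W (hsub x p) -> perp W (hsub y q) -> hnorm (hsub p q) <= hnorm (hsub x y).
Proof.
move=> sW Wp Wq hp hq; have Wpq := subspaceB _ _ _ sW Wp Wq.
have e : rin (hsub p q) (hsub p q) = rin (hsub x y) (hsub p q).
  have := hp _ Wpq; have := hq _ Wpq; rewrite !rinlE; lra.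
have := cauchy_schwarz (hsub x y) (hsub p q); rewrite -e -hnorm_sqr.
have := hnorm_ge0 (hsub p q); have := hnorm_ge0 (hsub x y); nra.
Qed.

Lemma projection_uniq W x p q : subspace W -> W p -> W q ->
  perp W (hsub x p) -> perp W (hsub x q) -> p = q.
Proof.
move=> sW Wp Wq hp hq; apply: hsub_eq0; apply: hnorm_eq0.
have := projection_le _ _ _ _ _ sW Wp Wq hp hq; rewrite hsubxx hnorm0.
by have := hnorm_ge0 (hsub p q); lra.
Qed.

End HilbertBasics.

(** * Closed subspaces as Hilbert spaces *)

Section SubHilbert.
Variables (V : Hilbert) (W : V -> Prop).
Hypothesis sW : subspace W.

Let carrier := {x : V | W x}.

Lemma sub_eq (x y : carrier) : proj1_sig x = proj1_sig y -> x = y.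
Proof. by case: x y => x wx [y wy] /= e; subst y; rewrite (proof_irrelevance _ wx wy). Qed.

Lemma subspace_opp (x : V) : W x -> W (hopp x).
Proof. by rewrite hoppE; case: sW => _ [_ [WZ _]]; exact: WZ. Qed.

Definition sub_hilbert : Hilbert.
Proof.
refine (@MkHilbert carrier (exist _ h0 (proj1 sW))
  (fun x y => exist _ (hadd (proj1_sig x) (proj1_sig y))
     (proj1 (proj2 sW) _ _ (proj2_sig x) (proj2_sig y)))
  (fun x => exist _ (hopp (proj1_sig x)) (subspace_opp _ (proj2_sig x)))
  (fun a x => exist _ (hscal a (proj1_sig x))
     (proj1 (proj2 (proj2 sW)) a _ (proj2_sig x)))
  (fun x y => hinner (proj1_sig x) (proj1_sig y)) _ _ _ _ _ _ _ _ _ _ _ _ _ _).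
- by move=> x y z; apply: sub_eq; exact: haddA.
- by move=> x y; apply: sub_eq; exact: haddC.
- by move=> x; apply: sub_eq; exact: hadd0.
- by move=> x; apply: sub_eq; exact: haddN.
- by move=> a b x; apply: sub_eq; exact: hscalA.
- by move=> x; apply: sub_eq; exact: hscal1.
- by move=> a b x; apply: sub_eq; exact: hscalDl.
- by move=> a x y; apply: sub_eq; exact: hscalDr.
- by move=> x y; exact: hinner_sym.
- by move=> x y z; exact: hinner_addl.
- by move=> a x y; exact: hinner_scall.
- by move=> x; exact: hinner_pos.
- by move=> x h; apply: sub_eq; exact: hinner_def.
move=> u hu; have [l hl] := @hcomplete V (fun n => proj1_sig (u n)) hu.
have Wl : W l.
  apply: (proj2 (proj2 (proj2 sW))) => eps e0; have [N hN] := hl _ e0.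
  exists (proj1_sig (u N)); split; [exact: (proj2_sig (u N))|exact: hN].
by exists (exist _ l Wl).
Defined.

End SubHilbert.

HB.instance Definition _ := Monoid.isComLaw.Build R 0 Rplus
  (fun x y z => esym (Rplus_assoc x y z)) Rplus_comm Rplus_0_l.
HB.instance Definition _ := Monoid.isComLaw.Build C (RtoC 0) Cplus
  Cplus_assoc Cplus_comm Cplus_0_l.

(** * Finite direct sums of a Hilbert space *)

Section DirectSum.
Variables (V : Hilbert) (I : finType).

Local Notation sumR F := (\big[Rplus/0]_(i : I) F i).
Local Notation sumC F := (\big[Cplus/RtoC 0]_(i : I) F i).

Lemma sumR_ge0 (F : I -> R) : (forall i, 0 <= F i) -> 0 <= sumR F.
Proof. by move=> h; elim/big_ind: _ => [|x y|//]; [right|lra]. Qed.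

Lemma sumR_ge (F : I -> R) i : (forall i, 0 <= F i) -> F i <= sumR F.
Proof.
move=> h; rewrite (bigD1 i) //=.
have : 0 <= \big[Rplus/0]_(j | j != i) F j.
  by elim/big_ind: _ => [|x y|//]; [right|lra].
lra.
Qed.

Lemma sumR_le (F : I -> R) c : (forall i, F i <= c) -> sumR F <= INR #|I| * c.
Proof.
move=> h; rewrite cardT enumT [index_enum I]unlock; elim: (Finite.enum I) => [|i s IH].
  by rewrite big_nil /=; lra.
by rewrite big_cons [size _]/= S_INR; have := h i; lra.
Qed.

Lemma sumR_const c : sumR (fun _ => c) = INR #|I| * c.
Proof.
rewrite cardT enumT [index_enum I]unlock; elim: (Finite.enum I) => [|i s IH]; first by rewrite big_nil /=; lra.
by rewrite big_cons [size _]/= S_INR IH; lra.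
Qed.

Lemma Re_sum (F : I -> C) : Re (sumC F) = sumR (fun i => Re (F i)).
Proof. exact: (big_morph Re). Qed.

Definition dsum_inner (x y : I -> V) := sumC (fun i => hinner (x i) (y i)).

Lemma Re_dsum_inner x y : Re (dsum_inner x y) = sumR (fun i => rin (x i) (y i)).
Proof. exact: Re_sum. Qed.

Definition direct_sum : Hilbert.
Proof.
refine (@MkHilbert (I -> V) (fun _ => h0) (fun x y i => hadd (x i) (y i))
  (fun x i => hopp (x i)) (fun a x i => hscal a (x i)) dsum_inner
  _ _ _ _ _ _ _ _ _ _ _ _ _ _).
- by move=> x y z; apply: functional_extensionality => i; exact: haddA.
- by move=> x y; apply: functional_extensionality => i; exact: haddC.
- by move=> x; apply: functional_extensionality => i; exact: hadd0.
- by move=> x; apply: functional_extensionality => i; exact: haddN.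
- by move=> a b x; apply: functional_extensionality => i; exact: hscalA.
- by move=> x; apply: functional_extensionality => i; exact: hscal1.
- by move=> a b x; apply: functional_extensionality => i; exact: hscalDl.
- by move=> a x y; apply: functional_extensionality => i; exact: hscalDr.
- move=> x y; rewrite /dsum_inner (big_morph Cconj (id1 := RtoC 0) (op1 := Cplus)).
  + by apply: eq_bigr => i _; exact: hinner_sym.
  + by move=> [a b] [c d]; rewrite /Cconj /Cplus /=; congr pair; ring.
  + by rewrite /Cconj /RtoC /=; congr pair; ring.
- move=> x y z; rewrite /dsum_inner -big_split.
  by apply: eq_bigr => i _; exact: hinner_addl.
- move=> a x y; rewrite /dsum_inner (big_morph (Cmult a) (id1 := RtoC 0) (op1 := Cplus)).
  + by apply: eq_bigr => i _; exact: hinner_scall.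
  + exact: Cmult_plus_distr_l.
  + exact: Cmult_0_r.
- by move=> x; rewrite Re_dsum_inner; apply: sumR_ge0 => i; exact: rin_ge0.
- move=> x h; apply: functional_extensionality => i; apply: rin_eq0.
  have := f_equal Re h; rewrite Re_dsum_inner [Re (RtoC 0)]/=.
  have := sumR_ge (fun i => rin (x i) (x i)) i (fun i => rin_ge0 (x i)).
  by have := rin_ge0 (x i); rewrite /=; lra.
move=> u hu.
have coord i : exists l, forall eps, 0 < eps -> exists N, forall m, (N <= m)%coq_nat ->
    hnorm (hsub (u m i) l) < eps.
  apply: hcomplete => eps e0; have [N hN] := hu _ e0; exists N => m k mN kN.
  apply: Rle_lt_trans (hN _ _ mN kN); apply: sqrt_le_1_alt; rewrite Re_dsum_inner.
  exact: (sumR_ge (fun i => rin (hsub (u m i) (u k i)) (hsub (u m i) (u k i))) i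
            (fun i => rin_ge0 _)).
have [l hl] := choice_fun _ _ _ coord.
exists l => eps e0.
(* Coordinatewise errors below [eta] add up to a square of at most [|I| eta^2 < eps^2]; the [+ 1]
   also covers an empty [I]. *)
pose eta := eps / (INR #|I| + 1).
have card0 := pos_INR #|I|.
have eta0 : 0 < eta by apply: Rdiv_lt_0_compat; lra.
have [N hN] := choice_fun _ _ _ (fun i => hl i _ eta0).
exists (\max_i N i) => m /leP hm; rewrite Re_dsum_inner.
have le i : rin (hsub (u m i) (l i)) (hsub (u m i) (l i)) <= eta * eta.
  have : hnorm (hsub (u m i) (l i)) < eta.
    by apply: hN; apply/leP; apply: leq_trans hm; exact: leq_bigmax.
  have := hnorm_ge0 (hsub (u m i) (l i)); rewrite -hnorm_sqr; nra.
rewrite -[X in _ < X](sqrt_square eps); last lra.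
apply: sqrt_lt_1_alt; split; first by apply: sumR_ge0 => i; exact: rin_ge0.
apply: Rle_lt_trans (sumR_le _ _ le) _.
have -> : eps = eta * (INR #|I| + 1) by rewrite /eta; field; lra.
have : 0 < eta * eta by nra.
nra.
Defined.

Lemma rin_direct_sum (x y : direct_sum) : rin x y = sumR (fun i => rin (x i) (y i)).
Proof. exact: Re_dsum_inner. Qed.

End DirectSum.

(** * The Hilbert space of square-summable complex sequences *)

Definition nsq (z : C) := z.1 * z.1 + z.2 * z.2.

Lemma nsq_ge0 z : 0 <= nsq z. Proof. by rewrite /nsq; nra. Qed.

Lemma nsq_eq0 z : nsq z = 0 -> z = RtoC 0.
Proof. by case: z => a b; rewrite /nsq /= => h; rewrite /RtoC; congr pair; nra. Qed.

Lemma nsqM a z : nsq (Cmult a z) = nsq a * nsq z.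
Proof. by rewrite /nsq /=; ring. Qed.

Lemma series_nonneg_term (a : nat -> R) n :
  (forall n, 0 <= a n) -> ex_series a -> a n <= Series a.
Proof.
move=> a0 /Series_correct ha.
have h := is_lim_seq_incr_compare (sum_n a) _ ha.
have : sum_n a n <= Series a.
  by apply: h => k; rewrite sum_Sn /plus /=; have := a0 (S k); lra.
case: n => [|n]; first by rewrite sum_O.
rewrite sum_Sn /plus /=.
have : 0 <= sum_n a n; last lra.
elim: n => [|n IH]; first by rewrite sum_O.
by rewrite sum_Sn /plus /=; have := a0 (S n); lra.
Qed.

Lemma series_nonneg_bounded (a : nat -> R) M : (forall n, 0 <= a n) ->
  (forall n, sum_n a n <= M) -> ex_series a /\ Series a <= M.
Proof.
move=> a0 aM.
have [l hl] : ex_finite_lim_seq (sum_n a).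
  apply: (ex_finite_lim_seq_incr _ M) => // n.
  by rewrite sum_Sn /plus /=; have := a0 (S n); lra.
split; first by exists l.
rewrite (is_series_unique a l) //.
exact: (is_lim_seq_le _ _ l M aM hl (is_lim_seq_const M)).
Qed.

Definition square_summable (a : nat -> C) := ex_series (fun n => nsq (a n)).

Lemma square_summable_add a b : square_summable a -> square_summable b ->
  square_summable (fun n => Cplus (a n) (b n)).
Proof.
move=> ha hb.
apply: (@ex_series_le R_AbsRing R_CompleteNormedModule _ (fun n => 2 * nsq (a n) + 2 * nsq (b n))).
  move=> n; rewrite /norm /= /abs /= Rabs_pos_eq; last exact: nsq_ge0.
  rewrite /nsq /=.
  have := Rle_0_sqr ((a n).1 - (b n).1); have := Rle_0_sqr ((a n).2 - (b n).2).
  by rewrite /Rsqr; lra.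
by apply: (@ex_series_plus R_AbsRing R_NormedModule); apply: (@ex_series_scal_l R_AbsRing).
Qed.

Lemma square_summable_scal c a : square_summable a -> square_summable (fun n => Cmult c (a n)).
Proof.
move=> ha; apply: (ex_series_ext (fun n => nsq c * nsq (a n))); first by move=> n; rewrite nsqM.
exact: (@ex_series_scal_l R_AbsRing).
Qed.

Lemma square_summable_opp a : square_summable a -> square_summable (fun n => Copp (a n)).
Proof.
by apply: ex_series_ext => n; rewrite /nsq /=; ring.
Qed.

Definition l2 := {a : nat -> C | square_summable a}.

Lemma l2_eq (a b : l2) : (forall n, sval a n = sval b n) -> a = b.
Proof.
case: a b => a ha [b hb] /= e; have {}e : a = b by apply: functional_extensionality.
by subst b; rewrite (proof_irrelevance _ ha hb).
Qed.

Lemma l2_prod (f : C -> C -> R) (a b : l2) : (forall x y, Rabs (f x y) <= nsq x + nsq y) ->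
  ex_series (fun n => f (sval a n) (sval b n)).
Proof.
move=> hf.
apply: (@ex_series_le R_AbsRing R_CompleteNormedModule _ (fun n => nsq (sval a n) + nsq (sval b n))).
  by move=> n; exact: hf.
apply: (@ex_series_plus R_AbsRing R_NormedModule); [exact: (svalP a)|exact: (svalP b)].
Qed.

(** [re_prod] and [im_prod] are the real and imaginary parts of [x] times the conjugate of [y], kept
    apart so that the inner product is a pair of real series. *)
Definition re_prod (x y : C) := x.1 * y.1 + x.2 * y.2.
Definition im_prod (x y : C) := x.2 * y.1 - x.1 * y.2.

Lemma l2_re (a b : l2) : ex_series (fun n => re_prod (sval a n) (sval b n)).
Proof.
apply: (l2_prod re_prod) => -[x y] [z t]; rewrite /nsq /re_prod /=.
have := Rle_0_sqr (x + z); have := Rle_0_sqr (y + t).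
have := Rle_0_sqr (x - z); have := Rle_0_sqr (y - t); rewrite /Rsqr => *.
by apply: Rabs_le; split; nra.
Qed.

Lemma l2_im (a b : l2) : ex_series (fun n => im_prod (sval a n) (sval b n)).
Proof.
apply: (l2_prod im_prod) => -[x y] [z t]; rewrite /nsq /im_prod /=.
have := Rle_0_sqr (y + z); have := Rle_0_sqr (x + t).
have := Rle_0_sqr (y - z); have := Rle_0_sqr (x - t); rewrite /Rsqr => *.
by apply: Rabs_le; split; nra.
Qed.

Definition l2_inner (a b : l2) : C :=
  (Series (fun n => re_prod (sval a n) (sval b n)), Series (fun n => im_prod (sval a n) (sval b n))).

Lemma square_summable0 : square_summable (fun _ => RtoC 0).
Proof.
apply: (proj1 (series_nonneg_bounded _ 0 _ _)) => n; first exact: nsq_ge0.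
elim: n => [|n IH]; first by rewrite sum_O /nsq /=; lra.
by rewrite sum_Sn /plus /nsq /= in IH *; lra.
Qed.

(** A Fatou argument: each partial sum of [|u_m - u_k|^2] is at most [c], a finite sum passes to the
    coordinatewise limit in [k], and the bound does not depend on its length [K]. *)
Lemma l2_limit (u : nat -> l2) (l : nat -> C) N c :
  (forall m k, (N <= m)%coq_nat -> (N <= k)%coq_nat ->
     Series (fun n => nsq (Cplus (sval (u m) n) (Copp (sval (u k) n)))) <= c) ->
  (forall n, is_lim_seq (fun m => (sval (u m) n).1) (l n).1 /\
             is_lim_seq (fun m => (sval (u m) n).2) (l n).2) ->
  forall m, (N <= m)%coq_nat ->
    ex_series (fun n => nsq (Cplus (sval (u m) n) (Copp (l n)))) /\
    Series (fun n => nsq (Cplus (sval (u m) n) (Copp (l n)))) <= c.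
Proof.
move=> hc hl m mN; apply: series_nonneg_bounded => [n|K]; first exact: nsq_ge0.
have lim : is_lim_seq (fun k => sum_n (fun n => nsq (Cplus (sval (u m) n) (Copp (sval (u k) n)))) K)
    (sum_n (fun n => nsq (Cplus (sval (u m) n) (Copp (l n)))) K).
  have term n : is_lim_seq (fun k => nsq (Cplus (sval (u m) n) (Copp (sval (u k) n))))
      (nsq (Cplus (sval (u m) n) (Copp (l n)))).
    have [h1 h2] := hl n.
    have d1 := is_lim_seq_minus' _ _ _ _ (is_lim_seq_const (sval (u m) n).1) h1.
    have d2 := is_lim_seq_minus' _ _ _ _ (is_lim_seq_const (sval (u m) n).2) h2.
    exact: is_lim_seq_plus' (is_lim_seq_mult' _ _ _ _ d1 d1) (is_lim_seq_mult' _ _ _ _ d2 d2).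
  elim: K => [|K IH].
    rewrite sum_O; refine (is_lim_seq_ext _ _ _ _ (term 0%N)) => k.
    by rewrite sum_O.
  rewrite sum_Sn; refine (is_lim_seq_ext _ _ _ _ (is_lim_seq_plus' _ _ _ _ IH (term (S K)))) => k.
  by rewrite sum_Sn.
refine (is_lim_seq_le_loc _ _ (Finite _) (Finite c) _ lim (is_lim_seq_const c)).
exists N => k kN; apply: Rle_trans (hc _ _ mN kN).
have ex : ex_series (fun n => nsq (Cplus (sval (u m) n) (Copp (sval (u k) n)))).
  apply: square_summable_add; first exact: (svalP (u m)).
  by apply: square_summable_opp; exact: (svalP (u k)).
refine (is_lim_seq_incr_compare _ _ (Series_correct _ ex) _ K) => n.
by rewrite sum_Sn /plus /=; have := nsq_ge0 (Cplus (sval (u m) (S n)) (Copp (sval (u k) (S n)))); rewrite /=; lra.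
Qed.

Lemma l2_complete (u : nat -> l2) :
  (forall eps, 0 < eps -> exists N, forall m k, (N <= m)%coq_nat -> (N <= k)%coq_nat ->
     sqrt (Series (fun n => nsq (Cplus (sval (u m) n) (Copp (sval (u k) n))))) < eps) ->
  exists l : l2, forall eps, 0 < eps -> exists N, forall m, (N <= m)%coq_nat ->
     sqrt (Series (fun n => nsq (Cplus (sval (u m) n) (Copp (sval l n))))) < eps.
Proof.
move=> hu.
have ex m k : ex_series (fun n => nsq (Cplus (sval (u m) n) (Copp (sval (u k) n)))).
  apply: square_summable_add; first exact: (svalP (u m)).
  by apply: square_summable_opp; exact: (svalP (u k)).
have ser m k : 0 <= Series (fun n => nsq (Cplus (sval (u m) n) (Copp (sval (u k) n)))).
  by apply: Rle_trans (series_nonneg_term _ 0%N _ (ex m k)) => [|n]; exact: nsq_ge0.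
have sq eps : 0 < eps -> exists N, forall m k, (N <= m)%coq_nat -> (N <= k)%coq_nat ->
    Series (fun n => nsq (Cplus (sval (u m) n) (Copp (sval (u k) n)))) <= eps * eps.
  move=> e0; have [N hN] := hu _ e0; exists N => m k mN kN.
  rewrite -(sqrt_sqrt _ (ser m k)).
  by apply: Rmult_le_compat; try exact: sqrt_pos; apply: Rlt_le; exact: hN.
have coord n (pr : C -> R) : (forall x y, pr (Cplus x (Copp y)) = pr x - pr y) ->
    (forall x, pr x * pr x <= nsq x) -> exists l, is_lim_seq (fun m => pr (sval (u m) n)) (Finite l).
  move=> prB prN.
  have [l hl] : {l | Un_cv (fun m => pr (sval (u m) n)) l}.
    apply: Rcomplete.R_complete => eps e0.
    have [N hN] := sq (eps / 2) ltac:(lra); exists N => m k mN kN.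
    have := hN _ _ mN kN.
    have := series_nonneg_term _ n (fun n => nsq_ge0 _) (ex m k).
    have := prN (Cplus (sval (u m) n) (Copp (sval (u k) n))); rewrite prB /R_dist.
    set a := _ - _ => h1 h2 h3; have {h1 h2 h3} h : a * a <= eps / 2 * (eps / 2) by lra.
    by clear -h e0; apply: Rabs_def1; nra.
  by exists l; apply/is_lim_seq_Reals.
have [l hl] : exists l : nat -> C, forall n, is_lim_seq (fun m => (sval (u m) n).1) (l n).1 /\
             is_lim_seq (fun m => (sval (u m) n).2) (l n).2.
  apply: (choice_fun nat C (fun n z => is_lim_seq (fun m => (sval (u m) n).1) z.1 /\
             is_lim_seq (fun m => (sval (u m) n).2) z.2)) => n.
  have [p hp] := coord n fst (fun x y => erefl) ltac:(by move=> x; rewrite /nsq; nra).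
  have [q hq] := coord n snd (fun x y => erefl) ltac:(by move=> x; rewrite /nsq; nra).
  by exists (p, q).
have sl : square_summable l.
  have [N hN] := sq 1 ltac:(lra).
  have [h _] := l2_limit u l N _ hN hl N (Nat.le_refl N).
  (* [l = u_N - (u_N - l)], a difference of two square-summable sequences. *)
  refine (ex_series_ext _ _ _ (square_summable_add _ _ (svalP (u N)) (square_summable_opp _ h))).
  by move=> n; rewrite /nsq /=; ring.
exists (exist _ l sl) => eps e0.
have [N hN] := sq (eps / 2) ltac:(lra); exists N => m mN.
have [h1 h2] := l2_limit u l N _ hN hl m mN.
rewrite -[X in _ < X](sqrt_square eps); last lra.
apply: sqrt_lt_1_alt; split; last by apply: Rle_lt_trans h2 _; nra.
by apply: Rle_trans (series_nonneg_term _ 0%N _ h1) => [|n]; exact: nsq_ge0.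
Qed.

Definition l2_hilbert : Hilbert.
Proof.
refine (@MkHilbert l2 (exist _ _ square_summable0)
  (fun a b => exist _ _ (square_summable_add _ _ (svalP a) (svalP b)))
  (fun a => exist _ _ (square_summable_opp _ (svalP a)))
  (fun c a => exist _ _ (square_summable_scal c _ (svalP a)))
  l2_inner _ _ _ _ _ _ _ _ _ _ _ _ _ _).
- by move=> x y z; apply: l2_eq => n /=; rewrite Cplus_assoc.
- by move=> x y; apply: l2_eq => n /=; rewrite Cplus_comm.
- by move=> x; apply: l2_eq => n /=; rewrite Cplus_0_r.
- by move=> x; apply: l2_eq => n /=; rewrite Cplus_opp_r.
- by move=> a b x; apply: l2_eq => n /=; rewrite Cmult_assoc.
- by move=> x; apply: l2_eq => n /=; rewrite Cmult_1_l.
- by move=> a b x; apply: l2_eq => n /=; rewrite Cmult_plus_distr_r.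
- by move=> a x y; apply: l2_eq => n /=; rewrite Cmult_plus_distr_l.
- move=> x y; rewrite /l2_inner /Cconj /=; congr pair.
    by apply: Series_ext => n; rewrite /re_prod; ring.
  by rewrite -Series_opp; apply: Series_ext => n; rewrite /im_prod; ring.
- move=> x y z; rewrite /l2_inner /Cplus /=; congr pair.
    rewrite -Series_plus; [|exact: l2_re|exact: l2_re].
    by apply: Series_ext => n; rewrite /re_prod /=; ring.
  rewrite -Series_plus; [|exact: l2_im|exact: l2_im].
  by apply: Series_ext => n; rewrite /im_prod /=; ring.
- move=> [a b] x y; rewrite /l2_inner /Cmult /=; congr pair.
    rewrite -!Series_scal_l -Series_minus.
    + by apply: Series_ext => n; rewrite /re_prod /im_prod /=; ring.
    + by apply: (@ex_series_scal_l R_AbsRing); exact: l2_re.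
    + by apply: (@ex_series_scal_l R_AbsRing); exact: l2_im.
  rewrite -!Series_scal_l -Series_plus.
  + by apply: Series_ext => n; rewrite /re_prod /im_prod /=; ring.
  + by apply: (@ex_series_scal_l R_AbsRing); exact: l2_im.
  + by apply: (@ex_series_scal_l R_AbsRing); exact: l2_re.
- move=> x; apply: Rle_trans (series_nonneg_term _ 0%N _ (l2_re x x)) => [|n]; exact: nsq_ge0.
- move=> x [h _]; apply: l2_eq => n; apply: nsq_eq0.
  have : nsq (sval x n) <= 0.
    by rewrite -h; apply: (series_nonneg_term (fun n => nsq (sval x n))) (l2_re x x) => k; exact: nsq_ge0.
  by have := nsq_ge0 (sval x n); lra.
exact: l2_complete.
Defined.

(** * Unitary representations and property (T) *)

Section Representations.
Context {K : AbsGroup} {V : Hilbert}.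
Variables (A : K -> Prop) (pi : K -> V -> V).
Hypothesis sA : subgroup A.
Hypothesis rep : unitary_rep A pi.

Lemma rep1 v : pi gone v = v. Proof. by case: rep => _ []. Qed.

Lemma repM g h v : A g -> A h -> pi (gmul g h) v = pi g (pi h v).
Proof. by case: rep => _ [+ _] Ag Ah; apply. Qed.

Lemma rep_inner g x y : A g -> hinner (pi g x) (pi g y) = hinner x y.
Proof. by case: rep => + _ => /[apply]; case=> _ [_ [_]]; apply. Qed.

Lemma rep_rin g x y : A g -> rin (pi g x) (pi g y) = rin x y.
Proof. by move=> Ag; rewrite /rin rep_inner. Qed.

Lemma repD g x y : A g -> pi g (hadd x y) = hadd (pi g x) (pi g y).
Proof. by case: rep => + _ => /[apply]; case=> + _; apply. Qed.

Lemma repZ g a x : A g -> pi g (hscal a x) = hscal a (pi g x).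
Proof. by case: rep => + _ => /[apply]; case=> _ [+ _]; apply. Qed.

Lemma repB g x y : A g -> pi g (hsub x y) = hsub (pi g x) (pi g y).
Proof. by move=> Ag; rewrite /hsub !hoppE repD // repZ. Qed.

Lemma rep0 g : A g -> pi g h0 = h0.
Proof. by move=> Ag; have := repB g h0 h0 Ag; rewrite !hsubxx. Qed.

Lemma rep_hnorm g x : A g -> hnorm (pi g x) = hnorm x.
Proof. by move=> Ag; apply: hnorm_eq_sqr; rewrite rep_rin. Qed.

Lemma repV g x : A g -> pi (ginv g) (pi g x) = x.
Proof.
move=> Ag; have Av : A (ginv g) by case: sA => _ [_]; apply.
by rewrite -repM // gmulVg rep1.
Qed.

Lemma rep_rinV g x y : A g -> rin (pi g x) y = rin x (pi (ginv g) y).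
Proof.
move=> Ag; have Av : A (ginv g) by case: sA => _ [_]; apply.
by rewrite -(rep_rin (ginv g)) // repV.
Qed.

Definition fixed_by v := forall g, A g -> pi g v = v.

Lemma fixed_subspace : subspace fixed_by.
Proof.
split; first by move=> g Ag; exact: rep0.
split; first by move=> x y hx hy g Ag; rewrite repD // hx // hy.
split; first by move=> a x hx g Ag; rewrite repZ // hx.
move=> l hl g Ag; apply: hsub_eq0; apply: hnorm_eq0.
apply: Rle_antisym; last exact: hnorm_ge0.
apply: lt_eps_le => eps e0; have [w [hw lw]] := hl (eps / 2) ltac:(lra).
have := hsub_trans (pi g l) (pi g w) l.
rewrite -repB // rep_hnorm // hw // hsub_sym; rewrite hsub_sym in lw.
by have := hsub_sym l w; lra.
Qed.

(** The adjoint of [pi g] is [pi (ginv g)], which preserves [W] too. *)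
Lemma perp_invariant W g x : (forall g x, A g -> W x -> W (pi g x)) -> A g ->
  perp W x -> perp W (pi g x).
Proof.
move=> hW Ag hx w Ww; rewrite rep_rinV //; apply: hx; apply: hW => //.
by case: sA => _ [_]; apply.
Qed.

End Representations.

(* Rescaling turns the unit vectors of the definition into arbitrary nonzero ones. *)
Lemma property_T_nonzero (K : AbsGroup) (A : K -> Prop) (V : Hilbert) (pi : K -> V -> V) :
  property_T A -> unitary_rep A pi ->
  (forall (Q : list K) eps, (forall g, In g Q -> A g) -> 0 < eps ->
     exists v, v <> h0 /\ forall g, In g Q -> hnorm (hsub (pi g v) v) < eps * hnorm v) ->
  exists v : V, v <> h0 /\ fixed_by A pi v.
Proof.
move=> T rep ai; apply: (T V pi rep) => Q eps QA e0.
have [v [v0 hv]] := ai Q eps QA e0; have n0 := hnorm_gt0 _ v0.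
have i0 : 0 < / hnorm v by exact: Rinv_0_lt_compat.
exists (hscal (RtoC (/ hnorm v)) v); split.
  by rewrite hnormZ; [field; lra|lra].
move=> g gQ; rewrite (repZ A pi) //; last exact: QA.
have -> : hadd (hscal (RtoC (/ hnorm v)) (pi g v)) (hopp (hscal (RtoC (/ hnorm v)) v)) =
   hscal (RtoC (/ hnorm v)) (hsub (pi g v) v).
  by apply: rin_ext => z; rewrite !rinlE; ring.
rewrite hnormZ; last lra.
have -> : eps = / hnorm v * (eps * hnorm v) by field; lra.
by apply: Rmult_lt_compat_l => //; exact: hv.
Qed.

Section Subrepresentation.
Variables (K : AbsGroup) (V : Hilbert) (A : K -> Prop) (pi : K -> V -> V) (W : V -> Prop).
Hypothesis sA : subgroup A.
Hypothesis rep : unitary_rep A pi.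
Hypothesis sW : subspace W.
Hypothesis hW : forall g x, A g -> W x -> W (pi g x).

(** Invariance of [W] is available only for [g] in [A], so the map is made total by the default
    value [x] when [pi g x] falls outside [W]. *)
Definition subrep (g : K) (x : sub_hilbert V W sW) : sub_hilbert V W sW :=
  match excluded_middle_informative (W (pi g (sval x))) with
  | left h => exist _ _ h
  | right _ => x
  end.

Lemma subrepE g x : A g -> sval (subrep g x) = pi g (sval x).
Proof.
move=> Ag; rewrite /subrep; case: excluded_middle_informative => // n; case: n.
by apply: hW => //; exact: (svalP x).
Qed.

Lemma subrep_unitary : unitary_rep A subrep.
Proof.
have [A1 [AM AV]] := sA.
split; last split.
- move=> g Ag; split; last split; last split.
  + by move=> x y; apply: sub_eq; rewrite subrepE //= (repD A pi) // !subrepE.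
  + by move=> a x; apply: sub_eq; rewrite subrepE //= (repZ A pi) // !subrepE.
  + move=> y; exists (subrep (ginv g) y); apply: sub_eq.
    have Av := AV _ Ag.
    by rewrite !subrepE // -(repM A pi rep) // gmulgV (rep1 A pi rep).
  + by move=> x y; rewrite /= !subrepE // (rep_inner A pi).
- move=> g h Ag Ah x; have Agh := AM _ _ Ag Ah.
  by apply: sub_eq; rewrite !subrepE // (repM A pi).
- by move=> x; apply: sub_eq; rewrite subrepE // (rep1 A pi).
Qed.

Lemma property_T_subspace : property_T A ->
  (forall (Q : list K) eps, (forall g, In g Q -> A g) -> 0 < eps ->
     exists v, W v /\ v <> h0 /\
       forall g, In g Q -> hnorm (hsub (pi g v) v) < eps * hnorm v) ->
  exists v, W v /\ v <> h0 /\ fixed_by A pi v.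
Proof.
move=> T ai.
have [Q eps QA e0|v [v0 hv]] := property_T_nonzero K A _ subrep T subrep_unitary.
  have [v [Wv [v0 hv]]] := ai Q eps QA e0.
  exists (exist _ v Wv); split=> [[]//|g gQ].
  have := hv g gQ; rewrite -(subrepE g (exist _ v Wv)) //; exact: QA.
exists (sval v); split; first exact: (svalP v).
split=> [e|g Ag]; first by apply: v0; exact: sub_eq.
by rewrite -subrepE // hv.
Qed.

End Subrepresentation.

(* On the orthogonal complement of the fixed vectors there are no fixed vectors, hence by (T)
   no almost fixed ones. *)
Lemma near_fixed (K : AbsGroup) (V : Hilbert) (A : K -> Prop) (pi : K -> V -> V) (d : R) :
  subgroup A -> unitary_rep A pi -> property_T A -> 0 < d ->
  exists (Q : list K) (eps : R), (forall g, In g Q -> A g) /\ 0 < eps /\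
    forall v p, (forall g, In g Q -> hnorm (hsub (pi g v) v) <= eps * hnorm v) ->
      fixed_by A pi p -> perp (fixed_by A pi) (hsub v p) -> hnorm (hsub v p) <= d * hnorm v.
Proof.
move=> sA rep T d0; apply: NNPP => nex.
have sF := fixed_subspace A pi rep.
have inv g x : A g -> perp (fixed_by A pi) x -> perp (fixed_by A pi) (pi g x).
  move=> Ag; apply: (perp_invariant A pi sA rep) => // k y Ak hy m Am.
  by rewrite !hy.
have [|w [hw [w0 hf]]] := property_T_subspace K V A pi _ sA rep (perp_subspace _ sF) inv T.
(* Since [p] is fixed, [v] and [v - p] are displaced equally. If [|v - p| > d |v|], a displacement
   of at most [eps d |v|] is below [eps |v - p|], so [v - p] is almost fixed in the complement. *)
- move=> Q eps QA e0; apply: NNPP => nv; apply: nex; exists Q, (eps * d).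
  split=> //; split; first by nra.
  move=> v p hv hp hvp; apply: Rnot_lt_le => lt; apply: nv.
  exists (hsub v p); split=> //; split=> [e|g gQ].
    by move: lt; rewrite e hnorm0; have := hnorm_ge0 v; nra.
  rewrite (repB A pi) //; last exact: QA.
  rewrite hp; last exact: QA.
  have -> : hsub (hsub (pi g v) p) (hsub v p) = hsub (pi g v) v.
    by apply: rin_ext => z; rewrite !rinlE; ring.
  apply: Rle_lt_trans (hv g gQ) _.
  by have := Rmult_lt_compat_l _ _ _ e0 lt; lra.
by apply: w0; exact: perp_self hf hw.
Qed.

(** The listed elements need not lie in [H] nor in distinct cosets. Going through the list, the
    coset of [a] contributes one of its elements in [H], provided that there is one not yet
    covered. *)
Lemma transversal (K : AbsGroup) (H N : K -> Prop) (T : list K) : subgroup H -> subgroup N ->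
  (forall x, H x -> exists t, In t T /\ N (gmul (ginv t) x)) ->
  exists (I : finType) (t : I -> K), (forall i, H (t i)) /\
    (forall x, H x -> exists i, N (gmul (ginv (t i)) x)) /\
    (forall i j, N (gmul (ginv (t i)) (t j)) -> i = j).
Proof.
move=> sH [N1 [NM NV]] cov.
suff [I [t [tH [tc tu]]]] : exists (I : finType) (t : I -> K), (forall i, H (t i)) /\
    (forall x, H x -> (exists t, In t T /\ N (gmul (ginv t) x)) ->
       exists i, N (gmul (ginv (t i)) x)) /\
    (forall i j, N (gmul (ginv (t i)) (t j)) -> i = j).
  by exists I, t; split=> //; split=> // x Hx; apply: tc => //; exact: cov.
elim: T {cov} => [|a T [I [t [tH [tc tu]]]]].
  by exists void, (fun _ => gone); split=> [[]|]; split=> [x _ [t []]|[]].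
case: (excluded_middle_informative (exists h, H h /\ N (gmul (ginv a) h) /\
    forall i, ~ N (gmul (ginv (t i)) h))) => [[h [Hh [ah nh]]]|nex].
  exists (option I), (fun o => if o is Some i then t i else h); split=> [[]//|].
  split=> [x Hx [b [[<-|bT] hb]]|[i|] [j|]] //.
  - exists None; have := NM _ _ (NV _ ah) hb; by rewrite !gE.
  - by have [i hi] := tc x Hx (ex_intro _ b (conj bT hb)); exists (Some i).
  - by move=> /tu ->.
  - by move=> /nh.
  - by move=> /NV; rewrite !gE => /nh.
exists I, t; split=> //; split=> // x Hx [b [[<-|bT] hb]]; last by apply: tc => //; exists b.
apply: NNPP => ni; apply: nex; exists x; split=> //; split=> // i hi; apply: ni; by exists i.
Qed.

(** * Averages over a finite transversal *)

HB.instance Definition _ (V : Hilbert) := Monoid.isComLaw.Build (hcar V) h0 (@hadd V)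
  (@haddA V) (@haddC V) (fun x => eq_trans (haddC h0 x) (hadd0 x)).

Lemma In_enum (I : finType) (i : I) : In i (enum I).
Proof.
have := mem_enum I i; elim: (enum I) => //= a l IH.
by rewrite inE => /orP [/eqP ->|/IH]; [left|right].
Qed.

Section Averaging.
Variables (K : AbsGroup) (V : Hilbert) (H N : K -> Prop) (pi : K -> V -> V).
Hypothesis sH : subgroup H.
Hypothesis sN : subgroup N.
Hypothesis NH : forall x, N x -> H x.
Hypothesis rep : unitary_rep H pi.
Variables (I : finType) (t : I -> K).
Hypothesis tH : forall i, H (t i).
Hypothesis tcov : forall x, H x -> exists i, N (gmul (ginv (t i)) x).
Hypothesis tuniq : forall i j, N (gmul (ginv (t i)) (t j)) -> i = j.

Local Notation avg u := (\big[@hadd V/h0]_(i : I) pi (t i) u).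

(** Left multiplication by [h] permutes the cosets [t i N]: [h (t i)] is [t (s i)] times an element
    of [N], and the latter fixes [u]. *)
Lemma average_fixed u : fixed_by N pi u -> fixed_by H pi (avg u).
Proof.
move=> hu h Hh; have [H1 [HM HV]] := sH; have [_ [NM NV]] := sN.
have [s hs] := choice_fun _ _ (fun i j => N (gmul (ginv (t j)) (gmul h (t i))))
  (fun i => tcov _ (HM _ _ Hh (tH i))).
have inj : injective s.
  move=> i j e; apply: tuniq; have := hs j; rewrite -e => hj.
  by have := NM _ _ (NV _ (hs i)) hj; rewrite !gE.
rewrite (big_morph (pi h) (id1 := h0) (op1 := hadd)).
- rewrite [RHS](reindex_inj inj); apply: eq_bigr => i _.
  have Hn := NH _ (hs i).
  rewrite -[in RHS](hu _ (hs i)) -!(repM H pi) //.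
  by rewrite gmulKVg.
- by move=> x y; rewrite (repD H pi).
- by rewrite (rep0 H pi).
Qed.

(** A displacement smaller than [|u|] forces a positive real inner product of [pi (t i) u] with [u],
    so the sum has positive inner product with [u]. *)
Lemma average_neq0 u : u <> h0 -> (forall i, hnorm (hsub (pi (t i) u) u) < hnorm u) ->
  avg u <> h0.
Proof.
move=> u0 hu e; have [i _] := tcov _ (proj1 sH).
have n0 := hnorm_gt0 _ u0.
have pos j : 0 <= rin (pi (t j) u) u.
  have := hu j; have := hnorm_ge0 (hsub (pi (t j) u) u) => a b.
  have : rin (hsub (pi (t j) u) u) (hsub (pi (t j) u) u) < rin u u.
    by rewrite -!hnorm_sqr; nra.
  by rewrite !rinE (rep_rin H pi) // (rin_sym u (pi (t j) u)); have := rin_ge0 u; lra.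
have posi : 0 < rin (pi (t i) u) u.
  have := hu i; have := hnorm_ge0 (hsub (pi (t i) u) u) => a b.
  have : rin (hsub (pi (t i) u) u) (hsub (pi (t i) u) u) < rin u u.
    by rewrite -!hnorm_sqr; nra.
  by rewrite !rinE (rep_rin H pi) // (rin_sym u (pi (t i) u)) -hnorm_sqr; nra.
have := f_equal (fun x => rin x u) e; rewrite rin0l.
rewrite (big_morph (fun x => rin x u) (id1 := 0) (op1 := Rplus)).
- have := sumR_ge I (fun j => rin (pi (t j) u) u) i pos; lra.
- by move=> x y; rewrite rinDl.
- exact: rin0l.
Qed.

End Averaging.

(** * Commuting copies of a group with property (T) *)

Section CommutingFamily.
Variables (K : AbsGroup) (H : K -> Prop) (G : AbsGroup) (A : G -> Prop) (I : finType)
  (delta : I -> G -> K).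
Hypothesis sH : subgroup H.
Hypothesis sA : subgroup A.
Hypothesis TA : property_T A.
Hypothesis delta1 : forall i, delta i gone = gone.
Hypothesis deltaM : forall i x y, delta i (gmul x y) = gmul (delta i x) (delta i y).
Hypothesis deltaH : forall i x, A x -> H (delta i x).
Hypothesis deltaC : forall i j x y, i <> j ->
  gmul (delta i x) (delta j y) = gmul (delta j y) (delta i x).

Variables (V : Hilbert) (pi : K -> V -> V).
Hypothesis rep : unitary_rep H pi.

Let pi_ i (x : G) := pi (delta i x).

Lemma coordinate_rep i : unitary_rep A (pi_ i).
Proof.
split; last split.
- by move=> g Ag; case: rep => + _; apply; exact: deltaH.
- by move=> g h Ag Ah v; rewrite /pi_ deltaM (repM H pi) //; exact: deltaH.
- by move=> v; rewrite /pi_ delta1 (rep1 H pi).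
Qed.

(** Induction on the copies: a vector [u] near [v] fixed by the copies in [s] is projected onto the
    vectors fixed by copy [i]. This projection commutes with the other copies, so their invariance
    survives. *)
Lemma near_fixed_family (s : list I) : uniq s -> forall d, 0 < d ->
  exists (Q : list K) (eps : R), (forall g, In g Q -> H g) /\ 0 < eps /\
    forall v, (forall g, In g Q -> hnorm (hsub (pi g v) v) <= eps * hnorm v) ->
      exists u, hnorm (hsub v u) <= d * hnorm v /\ forall i, i \in s -> fixed_by A (pi_ i) u.
Proof.
elim: s => [_ d d0|i s IH /= /andP [nis us] d d0].
  exists nil, 1; split=> //; split; first lra.
  move=> v _; exists v; split=> //; rewrite hsubxx hnorm0.
  by have := hnorm_ge0 v; nra.
have [Q [e [QH [e0 hQ]]]] := IH us (d / 2) ltac:(lra).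
have d20 : 0 < d / 2 by lra.
have [Q' [e' [QA' [e0' hQ']]]] := near_fixed G V A (pi_ i) _ sA (coordinate_rep i) TA d20.
exists (Q ++ List.map (delta i) Q')%list, (Rmin e e'); split.
  move=> g gQ; case: (in_app_or _ _ _ gQ) => [/QH //|h].
  have [x [<- xQ]] := proj1 (in_map_iff _ _ _) h.
  by apply: deltaH; exact: QA'.
split; first exact: Rmin_pos.
move=> v hv; have nv := hnorm_ge0 v.
have [u [vu hu]] : exists u, hnorm (hsub v u) <= d / 2 * hnorm v /\
    forall i, i \in s -> fixed_by A (pi_ i) u.
  apply: hQ => g gQ; apply: Rle_trans (hv g (in_or_app _ _ _ (or_introl gQ))) _.
  by apply: Rmult_le_compat_r => //; exact: Rmin_l.
have sF := fixed_subspace A (pi_ i) (coordinate_rep i).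
have [p [Fp hp]] := projection _ v sF.
have [q [Fq hq]] := projection _ u sF.
have vp : hnorm (hsub v p) <= d / 2 * hnorm v.
  apply: hQ' => // g gQ.
  apply: Rle_trans (hv _ (in_or_app _ _ _ (or_intror (in_map (delta i) _ _ gQ)))) _.
  by apply: Rmult_le_compat_r => //; exact: Rmin_r.
(* The projection [p] of [v] only serves the estimate [|v - q| <= |v - p| + |p - q| <= |v - p| + |v
   - u|], two halves of [d |v|]. *)
have pq := projection_le _ _ _ _ _ sF Fp Fq hp hq.
exists q; split; first by have := hsub_trans v p q; lra.
move=> j; rewrite inE => /orP [/eqP -> //|js] x Ax.
have ij : i <> j by move=> e1; move: nis; rewrite e1 js.
have Hx := deltaH j x Ax.
have invF g y : H g -> (exists2 z, A z & g = delta j z) ->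
    fixed_by A (pi_ i) y -> fixed_by A (pi_ i) (pi g y).
  move=> Hg [z Az gz] hy m Am; rewrite /pi_ -(repM H pi) //; last exact: deltaH.
  rewrite gz deltaC // -gz (repM H pi) //; last exact: deltaH.
  by congr (pi g _); exact: hy.
(* The image of [q] under copy [j] is again a projection of [u]: it is fixed by copy [i], and its
   error is the image of [u - q] because copy [j] fixes [u]. *)
apply: (projection_uniq _ u _ _ sF) => //.
  by apply: invF => //; exists x.
rewrite -{1}(hu j js x Ax) /pi_ -(repB H pi) // => w Fw.
rewrite (rep_rinV H pi) //; apply: hq; apply: invF => //.
  by case: sH => _ [_]; apply.
exists (ginv x); first by case: sA => _ [_]; apply.
apply: (@gmul_injl _ (delta j x)); rewrite -deltaM !gmulgV delta1; by [].
Qed.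

Definition family_group := gen (fun z => exists i x, A x /\ z = delta i x).

Lemma family_group_sub z : family_group z -> H z.
Proof. by apply: gen_min => // y [i [x [Ax ->]]]; exact: deltaH. Qed.

Lemma fixed_family_group u : (forall i, fixed_by A (pi_ i) u) -> fixed_by family_group pi u.
Proof.
move=> hu z hz; suff [] : H z /\ pi z u = u by [].
have [H1 [HM HV]] := sH.
apply: (gen_min _ (fun z => H z /\ pi z u = u) _ _ _ hz).
  split; first by rewrite (rep1 H pi).
  split=> [x y [Hx ex] [Hy ey]|x [Hx ex]].
    by rewrite (repM H pi) // ey; split=> //; exact: HM.
  by split; [exact: HV|rewrite -{1}ex (repV H pi)].
by move=> y [i [x [Ax ->]]]; split; [exact: deltaH|exact: hu].
Qed.

Lemma invariant_vector_extension (T : list K) :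
  (forall h, H h -> exists t, In t T /\ family_group (gmul (ginv t) h)) ->
  (forall (Q : list K) (eps : R), (forall g, In g Q -> H g) -> 0 < eps ->
     exists v : V, hnorm v = 1 /\
       forall g, In g Q -> hnorm (hadd (pi g v) (hopp v)) < eps) ->
  exists v : V, v <> h0 /\ forall g, H g -> pi g v = v.
Proof.
move=> cov ai; have [J [t [tH [tc tu]]]] := transversal K H _ T sH (gen_subgroup _) cov.
(* With [|v| = 1], the constant [1/8] gives [|u| >= 7/8], while each [t j] displaces [u] by less
   than [3/8], as [average_neq0] requires. *)
have [Q [e [QH [e0 hQ]]]] := near_fixed_family (enum I) (enum_uniq I) (1/8) ltac:(lra).
have e8 : 0 < Rmin e (1/8) by apply: Rmin_pos => //; lra.
have [g|v [v1 hv]] := ai (Q ++ List.map t (enum J))%list (Rmin e (1/8)) _ e8.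
  move=> gQ; case: (in_app_or _ _ _ gQ) => [/QH //|h].
  by have [j [<- _]] := proj1 (in_map_iff _ _ _) h.
have [u [vu hu]] : exists u, hnorm (hsub v u) <= 1/8 * hnorm v /\
    forall i, i \in enum I -> fixed_by A (pi_ i) u.
  apply: hQ => g gQ; rewrite v1 Rmult_1_r; apply: Rlt_le; apply: Rlt_le_trans (Rmin_l _ _).
  by apply: hv; apply: in_or_app; left.
rewrite v1 in vu.
have n78 : 7/8 <= hnorm u by have := hnormB_ge v u; rewrite v1; lra.
have fixN := fixed_family_group u (fun i => hu i (mem_enum _ i)).
exists (\big[@hadd V/h0]_(j : J) pi (t j) u); split; last first.
  exact: (average_fixed K V H family_group pi sH (gen_subgroup _) family_group_sub rep).
apply: (average_neq0 K V H family_group pi sH rep J t tH tc).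
  by move=> u0; rewrite u0 hnorm0 in n78; lra.
move=> j.
have tv : hnorm (hsub (pi (t j) v) v) < 1/8.
  apply: Rlt_le_trans (Rmin_r e _); apply: hv; apply: in_or_app; right.
  by apply: in_map; exact: In_enum.
have := hsub_trans (pi (t j) u) (pi (t j) v) u.
rewrite -(repB H pi) // (rep_hnorm H pi) // (hsub_sym u v).
by have := hsub_trans (pi (t j) v) v u; lra.
Qed.

End CommutingFamily.

Lemma property_T_extension (K : AbsGroup) (H : K -> Prop) (G : AbsGroup) (A : G -> Prop)
    (I : finType) (delta : I -> G -> K) (T : list K) :
  subgroup H -> subgroup A -> property_T A ->
  (forall i, delta i gone = gone) ->
  (forall i x y, delta i (gmul x y) = gmul (delta i x) (delta i y)) ->
  (forall i x, A x -> H (delta i x)) ->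
  (forall i j x y, i <> j -> gmul (delta i x) (delta j y) = gmul (delta j y) (delta i x)) ->
  (forall h, H h -> exists t, In t T /\ family_group K G A I delta (gmul (ginv t) h)) ->
  property_T H.
Proof.
move=> sH sA TA d1 dM dH dC cov V pi rep.
exact: (invariant_vector_extension K H G A I delta sH sA TA d1 dM dH dC V pi rep T cov).
Qed.

(** * Induction of representations from a subgroup of finite index *)

Section InducedRepresentation.
Variables (K : AbsGroup) (D : K -> Prop) (V : Hilbert) (pi : K -> V -> V).
Hypothesis sD : subgroup D.
Hypothesis rep : unitary_rep D pi.
Variables (I : finType) (t : I -> K) (idx : K -> I).
Hypothesis idxP : forall x, D (gmul (ginv (t (idx x))) x).
Hypothesis tuniq : forall i j, D (gmul (ginv (t i)) (t j)) -> i = j.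

Let D1 : D gone. Proof. by case: sD. Qed.
Let DM x y : D x -> D y -> D (gmul x y). Proof. by case: sD => _ [+ _]; apply. Qed.
Let DV x : D x -> D (ginv x). Proof. by case: sD => _ [_]; apply. Qed.

Lemma idx_eq x j : D (gmul (ginv (t j)) x) -> idx x = j.
Proof.
by move=> h; apply: tuniq; have := DM _ _ (idxP x) (DV _ h); rewrite !gE.
Qed.

(** [ginv g] sends the coset of [t i] to that of index [ind_idx g i], with the cocycle relation
    [g t_(ind_idx g i) = t_i (ind_coc g i)]. In [ind_rep], [F i] stands for the value at [t i] of a
    function [f] on [K] with [f (k d) = pi (d^-1) (f k)], and [g] acts by left translation. *)
Definition ind_idx g i := idx (gmul (ginv g) (t i)).
Definition ind_coc g i := gmul (ginv (t i)) (gmul g (t (ind_idx g i))).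

Lemma ind_cocP g i : D (ind_coc g i).
Proof. by have := DV _ (idxP (gmul (ginv g) (t i))); rewrite !gE. Qed.

Lemma ind_idx_inj g : injective (ind_idx g).
Proof.
move=> i j e; apply: tuniq; have := idxP (gmul (ginv g) (t i)).
rewrite -/(ind_idx g i) e => /DV hi.
by have := DM _ _ hi (idxP (gmul (ginv g) (t j))); rewrite !gE.
Qed.

Lemma ind_idxM g h i : ind_idx (gmul g h) i = ind_idx h (ind_idx g i).
Proof.
apply: idx_eq.
have a := idxP (gmul (ginv g) (t i)).
have b := idxP (gmul (ginv h) (t (ind_idx g i))).
by have := DM _ _ b a; rewrite !gE.
Qed.

Definition ind_rep (g : K) (F : direct_sum V I) : direct_sum V I :=
  fun i => pi (ind_coc g i) (F (ind_idx g i)).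

Lemma ind_repM g h F : ind_rep (gmul g h) F = ind_rep g (ind_rep h F).
Proof.
apply: functional_extensionality => i; rewrite /ind_rep.
rewrite -(repM D pi) ?ind_idxM; [|exact: rep|exact: ind_cocP|exact: ind_cocP].
by congr (pi _ _); rewrite /ind_coc ind_idxM !gE.
Qed.

Lemma ind_rep1 F : ind_rep gone F = F.
Proof.
apply: functional_extensionality => i; rewrite /ind_rep.
have e : ind_idx gone i = i by apply: idx_eq; rewrite !gE.
by rewrite /ind_coc e !gE (rep1 D pi).
Qed.

Lemma ind_rep_unitary : unitary_rep (@allG K) ind_rep.
Proof.
split; last by split=> [g h _ _ F|F]; [exact: ind_repM|exact: ind_rep1].
move=> g _; split; last split; last split.
- by move=> x y; apply: functional_extensionality => i; apply: (repD D pi) => //; exact: ind_cocP.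
- by move=> a x; apply: functional_extensionality => i; apply: (repZ D pi) => //; exact: ind_cocP.
- by move=> y; exists (ind_rep (ginv g) y); rewrite -ind_repM gmulgV ind_rep1.
move=> x y; rewrite /= /dsum_inner [RHS](reindex_inj (ind_idx_inj g)).
by apply: eq_bigr => i _; apply: (rep_inner D pi) => //; exact: ind_cocP.
Qed.

(** The element [t_i d t_i^-1] keeps the index [i] and has cocycle [d] there. *)
Lemma ind_rep_fixed F i d : fixed_by (@allG K) ind_rep F -> D d -> pi d (F i) = F i.
Proof.
move=> hF Dd; have := f_equal (fun f => f i) (hF (gmul (t i) (gmul d (ginv (t i)))) Logic.I).
rewrite /ind_rep /ind_coc.
have -> : ind_idx (gmul (t i) (gmul d (ginv (t i)))) i = i.
  by apply: idx_eq; rewrite !gE; exact: DV.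
by rewrite !gE.
Qed.

End InducedRepresentation.

(** If [v] is almost fixed by the cocycle values of [Q], the constant family [v] is almost fixed by
    [Q] in the induced representation. Conversely, any nonzero coordinate of an invariant family is
    a vector fixed by [D]. *)
Lemma property_T_finite_index (K : AbsGroup) (D : K -> Prop) :
  property_T (@allG K) -> subgroup D -> finite_index D -> property_T D.
Proof.
move=> T sD [L cov] V pi rep ai.
have sK : subgroup (@allG K) by [].
have [I [t [_ [tc tu]]]] := transversal K (@allG K) D L sK sD (fun x _ => cov x).
have [idx hidx] := choice_fun _ _ _ (fun x => tc x Logic.I).
have rep' := ind_rep_unitary K D V pi sD rep I t idx hidx tu.
have [Q eps _ e0|F [F0 hF]] := property_T_nonzero K _ _ _ T rep'.
  pose c g i := ind_coc K I t idx g i.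
  have [q|v [v1 hv]] := ai (List.flat_map (fun g => List.map (c g) (enum I)) Q) (eps / 2) _ ltac:(lra).
    move=> h; have [g [_ h']] := proj1 (in_flat_map _ _ _) h.
    have [i [<- _]] := proj1 (in_map_iff _ _ _) h'; exact: (ind_cocP K D sD I t idx hidx).
  (* A nonempty index set makes the constant family nonzero and the final estimate strict. *)
  have card1 : 1 <= INR #|I|.
    rewrite -[1]/(INR 1); apply: le_INR; apply/leP.
    by apply/card_gt0P; exists (idx gone).
  have vv : rin v v = 1 by rewrite -hnorm_sqr v1; ring.
  have normF : rin ((fun _ => v) : direct_sum V I) (fun _ => v) = INR #|I|.
    by rewrite rin_direct_sum vv sumR_const; ring.
  exists (fun _ => v); split=> [e|g gQ].
    by move: normF; rewrite e rin0l; lra.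
  have n0 := hnorm_ge0 ((fun _ => v) : direct_sum V I).
  apply: hnorm_lt_sqr; first by nra.
  have -> : forall a b, a * b * (a * b) = a * a * (b * b) by move=> *; ring.
  rewrite hnorm_sqr normF rin_direct_sum.
  apply: (Rle_lt_trans _ (INR #|I| * (eps / 2 * (eps / 2)))); last by nra.
  apply: sumR_le => i.
  have h : hnorm (hsub (pi (c g i) v) v) < eps / 2.
    apply: hv; apply/in_flat_map; exists g; split=> //; apply: in_map; exact: In_enum.
  have := hnorm_ge0 (hsub (pi (c g i) v) v).
  change (0 <= hnorm (hsub (pi (c g i) v) v) ->
    rin (hsub (pi (c g i) v) v) (hsub (pi (c g i) v) v) <= eps / 2 * (eps / 2)).
  by rewrite -hnorm_sqr; nra.
have [i Fi] : exists i, F i <> h0.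
  apply: NNPP => n; apply: F0; apply: functional_extensionality => i.
  by apply: NNPP => ni; apply: n; exists i.
exists (F i); split=> // d Dd; exact: (ind_rep_fixed K D V pi sD I t idx hidx tu).
Qed.

(** * The diagonal representation attached to a real character *)

Definition expi (x : R) : C := (cos x, sin x).

Lemma nsq_expi x : nsq (expi x) = 1.
Proof. by rewrite /nsq /=; have := sin2_cos2 x; rewrite /Rsqr; lra. Qed.

Lemma expiD x y : expi (x + y) = Cmult (expi x) (expi y).
Proof. by rewrite /expi /Cmult /= cos_plus sin_plus; congr pair; ring. Qed.

Lemma expi0 : expi 0 = RtoC 1. Proof. by rewrite /expi cos_0 sin_0. Qed.

Lemma re_prodM a x y : re_prod (Cmult a x) (Cmult a y) = nsq a * re_prod x y.
Proof. by rewrite /re_prod /nsq /=; ring. Qed.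

Lemma im_prodM a x y : im_prod (Cmult a x) (Cmult a y) = nsq a * im_prod x y.
Proof. by rewrite /im_prod /nsq /=; ring. Qed.

(** [|e^(ix) - 1|^2 = 2 - 2 cos x = 4 sin(x/2)^2], and [|sin y| <= |y|]. *)
Lemma nsq_expi_sub1 x : nsq (Cplus (expi x) (Copp (RtoC 1))) <= x * x.
Proof.
have sin_le y : 0 <= y -> sin y * sin y <= y * y.
  case=> [y0|<-]; last by rewrite sin_0; lra.
  have [y1|y1] := Rle_lt_dec y 1; last by have := sin2_cos2 y; rewrite /Rsqr; nra.
  have s1 := sin_lt_x y y0.
  have s0 : 0 < sin y by apply: sin_gt_0 => //; have := PI2_1; lra.
  by nra.
have sin_le' y : sin y * sin y <= y * y.
  have [/sin_le //|y0] := Rle_lt_dec 0 y.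
  by have := sin_le (- y) ltac:(lra); rewrite sin_neg; lra.
have c : cos x = 1 - 2 * sin (x / 2) * sin (x / 2).
  by rewrite -cos_2a_sin; congr cos; field.
have := sin_le' (x / 2); have := sin2_cos2 x; rewrite /nsq /Rsqr /= c.
by lra.
Qed.

Section DiagonalRepresentation.
Variables (K : AbsGroup) (chi : K -> R).
Hypothesis chiM : forall x y, chi (gmul x y) = chi x + chi y.

Lemma chi1 : chi gone = 0.
Proof. by have := chiM gone gone; rewrite gmul1g; lra. Qed.

Definition phase g (n : nat) := expi (chi g / (INR n + 1)).

Lemma diag_summable g (a : l2) : square_summable (fun n => Cmult (phase g n) (sval a n)).
Proof.
apply: ex_series_ext (svalP a) => n; by rewrite nsqM nsq_expi Rmult_1_l.
Qed.

Definition diag_rep (g : K) (a : l2_hilbert) : l2_hilbert := exist _ _ (diag_summable g a).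

Lemma diag_repM g h a : diag_rep (gmul g h) a = diag_rep g (diag_rep h a).
Proof.
apply: l2_eq => n /=; rewrite Cmult_assoc -expiD; congr (Cmult (expi _) _).
by rewrite chiM; field; have := pos_INR n; lra.
Qed.

Lemma diag_rep1 a : diag_rep gone a = a.
Proof. by apply: l2_eq => n /=; rewrite /phase chi1 /Rdiv Rmult_0_l expi0 Cmult_1_l. Qed.

Lemma diag_rep_unitary : unitary_rep (@allG K) diag_rep.
Proof.
split; last by split=> [g h _ _ F|F]; [exact: diag_repM|exact: diag_rep1].
move=> g _; split; last split; last split.
- by move=> x y; apply: l2_eq => n /=; rewrite Cmult_plus_distr_l.
- by move=> a x; apply: l2_eq => n /=; rewrite !Cmult_assoc (Cmult_comm a).
- by move=> y; exists (diag_rep (ginv g) y); rewrite -diag_repM gmulgV diag_rep1.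
move=> x y; rewrite /= /l2_inner /=; congr pair; apply: Series_ext => n.
  by rewrite re_prodM nsq_expi Rmult_1_l.
by rewrite im_prodM nsq_expi Rmult_1_l.
Qed.

Lemma single_term_le (a : nat -> R) N M : 0 <= M -> (forall n, n <> N -> a n = 0) -> a N <= M ->
  forall n, sum_n a n <= M.
Proof.
move=> M0 a0 aN.
have aM n : a n <= M by have [->|/a0 ->] := Nat.eq_dec n N.
have z n : (n < N)%coq_nat -> sum_n a n = 0.
  elim: n => [|n IH] h; first by rewrite sum_O; apply: a0; lia.
  by rewrite sum_Sn IH ?a0 /plus /=; [lra|lia|lia].
elim=> [|n IH]; first by rewrite sum_O.
rewrite sum_Sn /plus /=; have [e|ne] := Nat.eq_dec (S n) N.
  by rewrite z ?e; [lra|lia].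
by rewrite a0 //; lra.
Qed.

Definition basis_seq (N n : nat) : C := if Nat.eq_dec n N then RtoC 1 else RtoC 0.

Lemma basis_summable N : square_summable (basis_seq N).
Proof.
apply: (proj1 (series_nonneg_bounded _ 1 _ _)); first by move=> n; exact: nsq_ge0.
apply: (single_term_le _ N); first lra.
  by move=> n nN; rewrite /basis_seq /nsq; case: Nat.eq_dec => //= _; lra.
by rewrite /basis_seq /nsq; case: Nat.eq_dec => //= _; lra.
Qed.

Definition basis N : l2_hilbert := exist _ _ (basis_summable N).

Lemma basis_norm N : 1 <= rin (basis N) (basis N).
Proof.
apply: Rle_trans (series_nonneg_term (fun n => nsq (basis_seq N n)) N _ (basis_summable N)).
  by rewrite /basis_seq /nsq; case: Nat.eq_dec => //= _; lra.
by move=> n; exact: nsq_ge0.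
Qed.

Lemma basis_almost_fixed N g :
  rin (hsub (diag_rep g (basis N)) (basis N)) (hsub (diag_rep g (basis N)) (basis N)) <=
  chi g / (INR N + 1) * (chi g / (INR N + 1)).
Proof.
pose a n := nsq (Cplus (Cmult (phase g n) (basis_seq N n)) (Copp (basis_seq N n))).
have [] // := series_nonneg_bounded a (chi g / (INR N + 1) * (chi g / (INR N + 1))).
  by move=> n; exact: nsq_ge0.
apply: (single_term_le _ N); first by have := Rle_0_sqr (chi g / (INR N + 1)).
  by move=> n nN; rewrite /a /basis_seq /nsq; case: Nat.eq_dec => //= _; ring.
rewrite /a /basis_seq; case: Nat.eq_dec => //= _.
by rewrite Cmult_1_r; exact: nsq_expi_sub1.
Qed.

(** The angles [1 / (n + 1)] lie in [(0, 1]], so no phase of [g] equals 1 and every coordinate of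
    [a] vanishes. *)
Lemma diag_rep_no_fixed g a : chi g = 1 -> diag_rep g a = a -> a = h0.
Proof.
move=> g1 e; apply: l2_eq => n /=.
have := f_equal (fun b : l2 => sval b n) e; rewrite /= /phase g1.
set x := 1 / _ => h.
have N0 := pos_INR n.
have x0 : 0 < x by apply: Rdiv_lt_0_compat; lra.
have x1 : x <= 1 by apply: (Rmult_le_reg_r (INR n + 1)); rewrite /x /Rdiv ?Rmult_assoc ?Rinv_l; lra.
have s0 : 0 < sin x by apply: sin_gt_0 => //; have := PI2_1; lra.
move: h; case: (sval a n) => p q [h1 h2].
have c1 : cos x <= 1 := proj2 (COS_bound x).
have cs := sin2_cos2 x; rewrite /Rsqr in cs.
(* This is [|e^(ix) - 1|^2]; multiplying [(e^(ix) - 1) (p + i q) = 0] by the conjugate factor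
   separates [p] from [q]. *)
have cn : 2 - 2 * cos x = (1 - cos x) * (1 - cos x) + sin x * sin x by nra.
have cpos : 0 < 2 - 2 * cos x by rewrite cn; nra.
have p0 : p * (2 - 2 * cos x) = 0 by rewrite cn; nra.
have q0 : q * (2 - 2 * cos x) = 0 by rewrite cn; nra.
by rewrite /RtoC; congr pair; nra.
Qed.

End DiagonalRepresentation.

Lemma property_T_no_real_char (K : AbsGroup) : property_T (@allG K) ->
  ~ exists chi, real_char K chi.
Proof.
move=> T [chi0 [chi0M [g0 ng0]]].
(* Normalised to take the value 1 at [g0], so that [diag_rep_no_fixed] applies. *)
pose chi g := chi0 g / chi0 g0.
have chiM x y : chi (gmul x y) = chi x + chi y by rewrite /chi chi0M; field.
have [Q eps _ e0|v [v0 hv]] := property_T_nonzero K _ _ _ T (diag_rep_unitary K chi chiM).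
  have [B [B0 hB]] : exists B, 0 < B /\ forall g, In g Q -> Rabs (chi g) <= B.
    elim: Q => [|q Q [B [B0 hB]]]; first by exists 1; split; [lra|].
    exists (B + Rabs (chi q)); have := Rabs_pos (chi q) => h; split; first lra.
    by move=> g [<-|/hB]; lra.
  have [N [hN N0]] := archimed_cor1 (eps / B) (Rdiv_lt_0_compat _ _ e0 B0).
  exists (basis N); have n1 := basis_norm N; split=> [e|g gQ].
    by rewrite e rin0l in n1; lra.
  apply: hnorm_lt_sqr; first by have := hnorm_ge0 (basis N); nra.
  have -> : forall a b, a * b * (a * b) = a * a * (b * b) by move=> *; ring.
  rewrite hnorm_sqr; apply: Rle_lt_trans (basis_almost_fixed K chi N g) _.
  have Npos := lt_0_INR _ N0.
  have small : Rabs (chi g / (INR N + 1)) < eps.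
    rewrite Rabs_mult (Rabs_pos_eq (/ _)); last by apply: Rlt_le; apply: Rinv_0_lt_compat; lra.
    have i1 : / (INR N + 1) < / INR N by apply: Rinv_lt_contravar; nra.
    have i0 : 0 < / (INR N + 1) by apply: Rinv_0_lt_compat; lra.
    apply: (Rle_lt_trans _ (B * / (INR N + 1))).
      by apply: Rmult_le_compat_r; [lra|exact: hB].
    have -> : eps = B * (eps / B) by field; lra.
    by apply: Rmult_lt_compat_l => //; lra.
  have [s1 s2] := Rabs_def2 _ _ small.
  have : chi g / (INR N + 1) * (chi g / (INR N + 1)) < eps * eps by nra.
  by nra.
apply: v0; apply: (diag_rep_no_fixed K chi g0); first by rewrite /chi; field.
exact: hv.
Qed.

Lemma property_T_derived (K : AbsGroup) : finitely_generated K -> property_T (@allG K) ->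
  property_T (derived (@allG K)) /\ finite_index (derived (@allG K)).
Proof.
move=> fg T; have [[fi _]|/property_T_no_real_char //] := finite_or_real_char K fg.
by split=> //; apply: property_T_finite_index => //; exact: derived_subgroup.
Qed.

Local Open Scope ring_scope.

(** * Wreath products *)

Section Wreath.
Variables (G : AbsGroup) (n : nat).
Local Notation W := (Wreath G n).

Definition base (f : 'Z_n -> G) : W := (f, 0).
Definition shift (a : 'Z_n) : W := (fun _ => gone, a).
Definition delta (i : 'Z_n) (x : G) : W := base (fun j => if j == i then x else gone).

Lemma wreath_eq (u v : W) : (forall i, u.1 i = v.1 i) -> u.2 = v.2 -> u = v.
Proof.
by case: u v => f a [g b] /= fg <-; congr pair; apply: functional_extensionality.
Qed.

Lemma base_mul f g : gmul (base f) (base g) = base (fun i => gmul (f i) (g i)).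
Proof. by apply: wreath_eq => [i|] /=; rewrite ?subr0 ?addr0. Qed.

Lemma base_inv f : ginv (base f) = base (fun i => ginv (f i)).
Proof. by apply: wreath_eq => [i|] /=; rewrite ?addr0 ?oppr0. Qed.

Lemma base_comm f g : commg (base f) (base g) = base (fun i => commg (f i) (g i)).
Proof. by rewrite /commg !base_inv !base_mul. Qed.

Lemma shift_mul a b : gmul (shift a) (shift b) = shift (a + b).
Proof. by apply: wreath_eq => [i|] //=; rewrite gmul1g. Qed.

Lemma shift_inv a : ginv (shift a) = shift (- a).
Proof. by apply: wreath_eq => [i|] //=; rewrite ginv1. Qed.

Lemma shift_conj a f :
  gmul (gmul (shift a) (base f)) (shift (- a)) = base (fun i => f (i - a)).
Proof. by apply: wreath_eq => [i|] /=; rewrite ?gmul1g ?gmulg1 // addr0 subrr. Qed.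

Lemma wreath_decomp (w : W) : w = gmul (base w.1) (shift w.2).
Proof. by apply: wreath_eq => [i|] /=; rewrite ?gmulg1 ?add0r. Qed.

Lemma deltaM i x y : delta i (gmul x y) = gmul (delta i x) (delta i y).
Proof.
by rewrite base_mul; apply: wreath_eq => [j|] //=; case: eqP; rewrite ?gmul1g.
Qed.

Lemma delta1 i : delta i gone = gone.
Proof. by apply: wreath_eq => [j|] //=; case: eqP. Qed.

Lemma deltaV i x : delta i (ginv x) = ginv (delta i x).
Proof. by rewrite base_inv; apply: wreath_eq => [j|] //=; case: eqP; rewrite ?ginv1. Qed.

Lemma delta_comm i j x y : i <> j ->
  gmul (delta i x) (delta j y) = gmul (delta j y) (delta i x).
Proof.
move=> ij; rewrite !base_mul; congr base; apply: functional_extensionality => k.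
case: (eqVneq k i) => [->|ki]; last by rewrite gmul1g gmulg1.
by case: eqP => // _; rewrite gmul1g gmulg1.
Qed.

Lemma delta_inj i x y : delta i x = delta i y -> x = y.
Proof. by move/(f_equal (fun w : W => w.1 i)); rewrite /= eqxx. Qed.

Lemma delta_shift i x : gmul (gmul (shift i) (delta 0 x)) (shift (- i)) = delta i x.
Proof. by rewrite shift_conj; apply: wreath_eq => [j|] //=; rewrite subr_eq0. Qed.

Lemma base_cons (f : 'Z_n -> G) i s : i \notin s ->
  base (fun j => if j \in i :: s then f j else gone) =
  gmul (delta i (f i)) (base (fun j => if j \in s then f j else gone)).
Proof.
move=> nis; rewrite base_mul; congr base; apply: functional_extensionality => j.
rewrite inE; case: (eqVneq j i) => [->|ji] /=; last by rewrite gmul1g.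
by rewrite (negbTE nis) gmulg1.
Qed.

Lemma base_enum (f : 'Z_n -> G) : base f = base (fun j => if j \in enum 'Z_n then f j else gone).
Proof. by congr base; apply: functional_extensionality => j; rewrite mem_enum. Qed.

(** An element of the base group is the product of its coordinates, taken along the enumeration of
    ['Z_n]. *)
Lemma base_subgroup (P : W -> Prop) (A : G -> Prop) f : subgroup P ->
  (forall i x, A x -> P (delta i x)) -> (forall i, A (f i)) -> P (base f).
Proof.
move=> [P1 [PM PV]] hd hf; rewrite base_enum; have := enum_uniq 'Z_n.
elim: (enum 'Z_n) => [_|i s IH /= /andP [nis us]]; first exact: P1.
by rewrite base_cons //; apply: PM; [apply: hd|apply: IH].
Qed.

Lemma derived_base w : derived (@wr_base G n) w ->
  w = base w.1 /\ forall i, derived (@allG G) (w.1 i).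
Proof.
have [D1 [DM DV]] := @derived_subgroup G.
move=> dw; suff [w2 hw] : w.2 = 0 /\ forall i, derived (@allG G) (w.1 i).
  by split=> //; apply: wreath_eq.
apply: (gen_min _ (fun w : W => w.2 = 0 /\ forall i, derived (@allG G) (w.1 i)) _ _ _ dw).
  split; first by [].
  split=> [x y [x2 hx] [y2 hy]|x [x2 hx]].
    by split=> [|i] /=; [rewrite x2 y2 addr0|apply: DM].
  by split=> [|i] /=; [rewrite x2 oppr0|apply: DV].
move=> _ [[f a] [[g b] [/= fa [gb ->]]]]; rewrite /wr_base /= in fa gb; subst a b.
change ((commg (base f) (base g)).2 = 0 /\
  forall i, derived (@allG G) ((commg (base f) (base g)).1 i)); rewrite base_comm.
by split=> // i; exact: derived_comm.
Qed.

Lemma wreath_finite_index (A : G -> Prop) : finite_index A ->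
  exists T : list W, forall h, exists t, In t T /\
    exists f, (forall i, A (f i)) /\ gmul (ginv t) h = base f.
Proof.
move=> [L hL].
(* A representative consists of a position in [L] for each coordinate and a shift; finite functions
   make these choices enumerable. *)
exists (List.map (fun ca : {ffun 'Z_n -> 'I_(length L)} * 'Z_n =>
    ((fun i => List.nth (ca.1 i) L gone), ca.2) : W)
  (enum {: {ffun 'Z_n -> 'I_(length L)} * 'Z_n})).
move=> [g a].
have ex i : exists k : 'I_(length L), A (gmul (ginv (List.nth k L gone)) (g i)).
  have [x [xL Ax]] := hL (g i); have [k [/ltP kL e]] := In_nth L x gone xL.
  by exists (Ordinal kL); rewrite /= e.
have [c hc] := choice_fun _ _ _ ex.
exists ((fun i => List.nth (c i) L gone), a); split.
  apply/in_map_iff; exists ([ffun i => c i], a); split; last exact: In_enum.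
  by apply: wreath_eq => [i|] //=; rewrite ffunE.
exists (fun i => gmul (ginv (List.nth (c (i + a)) L gone)) (g (i + a))); split=> // .
by apply: wreath_eq => [i|] /=; rewrite ?opprK ?addNr.
Qed.

(** The copies of [A] in the coordinates commute and generate [A^n], whose cosets by finitely many
    elements cover the whole wreath product and in particular [H]. *)
Lemma wreath_property_T (A : G -> Prop) (H : W -> Prop) : subgroup A -> finite_index A ->
  property_T A -> subgroup H -> (forall i x, A x -> H (delta i x)) -> property_T H.
Proof.
move=> sA /wreath_finite_index [T hT] TA sH hd.
apply: (property_T_extension W H G A 'Z_n delta T) => //.
- exact: delta1.
- exact: deltaM.
- by move=> *; exact: delta_comm.
move=> h _; have [t [tT [f [Af e]]]] := hT h; exists t; split=> //.
suff: family_group W G A 'Z_n delta (base f) by rewrite -e.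
apply: (base_subgroup _ A) => //; first exact: gen_subgroup.
by move=> i x Ax; apply: gen_base; exists i, x.
Qed.

Lemma wreath_finitely_generated : finitely_generated G -> finitely_generated W.
Proof.
case=> l hl.
exists (List.map shift (enum 'Z_n) ++ List.flat_map (fun i => List.map (delta i) l) (enum 'Z_n))%list.
set S := fun x => In x _.
have hs a : gen S (shift a) by apply: gen_base; apply: in_or_app; left; apply: in_map; exact: In_enum.
have hd i x : gen S (delta i x).
  apply: (gen_min _ (fun x => gen S (delta i x)) _ _ _ (hl x)).
    split; first by rewrite delta1; exact: gen_one.
    split=> [y z hy hz|y hy]; first by rewrite deltaM; exact: gen_mul.
    by rewrite deltaV; exact: gen_inv.
  move=> y yl; apply: gen_base; apply: in_or_app; right; apply/in_flat_map.
  by exists i; split; [exact: In_enum|exact: in_map].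
move=> w; rewrite (wreath_decomp w); apply: gen_mul => //.
exact: (base_subgroup _ (@allG G) _ (gen_subgroup _) (fun i x _ => hd i x)).
Qed.

(* All [delta i x] are conjugate, so modulo commutators the diagonal element is
   [delta 0 (x ^ n)]. *)
Lemma diagonal_in_derived x : (1 < n)%N -> derived (@allG G) (gpow x n) ->
  derived (@allG W) (base (fun _ => x)).
Proof.
move=> n1 hx; have sD := @derived_subgroup W; have cD := @derived_comm W.
have key : cgr (derived (@allG W)) (base (fun _ => x)) (gpow (delta 0 x) (size (enum 'Z_n))).
  rewrite base_enum; have := enum_uniq 'Z_n.
  elim: (enum 'Z_n) => [_|i s IH /= /andP [nis us]]; first by apply: cgr_refl.
  rewrite base_cons //; apply: cgr_mul => //; last exact: IH.
  rewrite -(delta_shift i) -shift_inv.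
  apply: (cgr_trans _ sD (gmul (gmul (delta 0 x) (shift i)) (ginv (shift i)))).
    by apply: cgr_mul => //; [exact: cgr_comm|exact: cgr_refl].
  by rewrite !gE; exact: cgr_refl.
apply: (proj2 (cgr1 (derived (@allG W)) _)); apply: (cgr_trans _ sD _ _ _ key).
apply: (proj1 (cgr1 (derived (@allG W)) _)).
(* Here [1 < n] matters: for smaller [n] the type ['Z_n] has two elements. *)
have sz : size (enum 'Z_n) = n by rewrite -cardE card_ord; exact: Zp_cast.
have pow m : gpow (delta 0 x) m = delta 0 (gpow x m).
  by elim: m => [|m IH] /=; rewrite ?delta1 // IH deltaM.
rewrite sz pow.
apply: (gen_min _ (fun x => derived (@allG W) (delta 0 x)) _ _ _ hx).
  have [D1 [DM DV]] := sD.
  split; first by rewrite delta1.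
  by split=> [y z hy hz|y hy]; rewrite ?deltaM ?deltaV; [apply: DM|apply: DV].
by move=> _ [y [z [_ [_ ->]]]]; rewrite /commg !deltaM !deltaV; exact: cD.
Qed.

End Wreath.

(** * Powers of two form a Sidon set *)

Lemma pow2_sum1 b c d : (expn 2 0 + expn 2 b = expn 2 c + expn 2 d)%N ->
  (0 = c /\ b = d)%N \/ (0 = d /\ b = c)%N.
Proof.
have inj x y : (expn 2 x = expn 2 y)%N -> x = y by move/eqP; rewrite eqn_exp2l // => /eqP.
case: c => [|c]; first by move=> /addnI/inj ->; left.
case: d => [|d]; first by rewrite [RHS]addnC => /addnI/inj ->; right.
case: b => [|b].
  by rewrite !expnS; have := expn_gt0 2 c; have := expn_gt0 2 d; lia.
by rewrite !expnS; lia.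
Qed.

(** Halve as long as all exponents are positive. Once one of them is 0, [pow2_sum1] settles the case
    by parity, after exchanging summands or sides. *)
Lemma pow2_sidon a b c d : (expn 2 a + expn 2 b = expn 2 c + expn 2 d)%N ->
  (a = c /\ b = d) \/ (a = d /\ b = c).
Proof.
elim: a b c d => [|a IH] b c d e; first by have := pow2_sum1 _ _ _ e; lia.
case: b e => [|b] e; first by rewrite addnC in e; have := pow2_sum1 _ _ _ e; lia.
case: c e => [|c] e; first by have := pow2_sum1 _ _ _ (esym e); lia.
case: d e => [|d] e.
  by rewrite [RHS]addnC in e; have := pow2_sum1 _ _ _ (esym e); lia.
have : (expn 2 a + expn 2 b = expn 2 c + expn 2 d)%N by move: e; rewrite !expnS; lia.
by move/IH; lia.
Qed.

(* Commutator identities reduce the claim to commutators of generators, once [C] is known to be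
   normalised by the generators. *)
Lemma derived_sub_of_generators (G : AbsGroup) (l : list G) (C : G -> Prop) :
  (forall g, gen (fun x => In x l) g) -> subgroup C ->
  (forall g x, In g l -> C x -> C (gmul (gmul (ginv g) x) g)) ->
  (forall g x, In g l -> C x -> C (gmul (gmul g x) (ginv g))) ->
  (forall g h, In g l -> In h l -> C (commg g h)) ->
  forall x, derived (@allG G) x -> C x.
Proof.
move=> hl sC J J' hc; have [C1 [CM CV]] := sC.
(* Both conjugations are proved together, since passing from [y] to its inverse exchanges them. *)
have normal y : forall x, C x ->
    C (gmul (gmul (ginv y) x) y) /\ C (gmul (gmul y x) (ginv y)).
  apply: (gen_min _ (fun y => forall x, C x ->
    C (gmul (gmul (ginv y) x) y) /\ C (gmul (gmul y x) (ginv y))) _ _ _ (hl y)).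
    split; first by move=> x Cx; rewrite !gE.
    split=> [u v hu hv x Cx|u hu x Cx]; last by rewrite ginvK; case: (hu x Cx).
    have [a _] := hu x Cx; have [a' _] := hv _ a.
    have [_ b] := hv x Cx; have [_ b'] := hu _ b.
    by split; [move: a'|move: b']; rewrite !gE.
  by move=> g gl x Cx; split; [exact: J|exact: J'].
(* From [[g, u v] = [g, v] v^-1 [g, u] v] and [[g, u^-1] = u [g, u]^-1 u^-1]; the next step uses the
   mirror identities in the first argument. *)
have comm_gen g y : In g l -> C (commg g y).
  move=> gl; apply: (gen_min _ (fun y => C (commg g y)) _ _ _ (hl y)) => [|h hhl]; last exact: hc.
  split; first by rewrite /commg !gE.
  split=> [u v hu hv|u hu].
    by have := CM _ _ hv (proj1 (normal v _ hu)); rewrite /commg !gE.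
  by have := proj2 (normal u _ (CV _ hu)); rewrite /commg !gE.
have comm x y : C (commg x y).
  apply: (gen_min _ (fun x => C (commg x y)) _ _ _ (hl x)) => [|g gl]; last exact: comm_gen.
  split; first by rewrite /commg !gE.
  split=> [u v hu hv|u hu].
    by have := CM _ _ (proj1 (normal v _ hu)) hv; rewrite /commg !gE.
  by have := proj2 (normal u _ (CV _ hu)); rewrite /commg !gE.
by move=> x; apply: gen_min => // _ [u [v [_ [_ ->]]]].
Qed.

(** * The subgroup generated by the shift and the spread generators *)

Section TwoGenerators.
Variables (G : AbsGroup) (l : list G) (n : nat).
Hypothesis hl : forall g, gen (fun x => In x l) g.
Hypothesis n1 : (1 < n)%N.
Hypothesis nl : (expn 2 (length l).+1 <= n)%N.

Let pows := [seq expn 2 i | i <- seq.iota 0%N (length l)].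

(* The [i]-th generator sits at position [2 ^ i]; powers of two form a Sidon set. *)
Definition spread (x : 'Z_n) : G := List.nth (index (x : nat) pows) l gone.

Definition pos (i : nat) : 'Z_n := (expn 2 i)%:R.

Lemma pos_nat i : (i < length l)%N -> pos i = expn 2 i :> nat.
Proof.
move=> il; rewrite /pos val_Zp_nat // modn_small //; apply: leq_trans nl.
by rewrite ltn_exp2l // ltnS ltnW.
Qed.

Lemma spread_pos i : (i < length l)%N -> spread (pos i) = List.nth i l gone.
Proof.
move=> il; rewrite /spread pos_nat // /pows index_map; last first.
  by move=> x y /eqP; rewrite eqn_exp2l // => /eqP.
by rewrite -{1}[i]add0n -(nth_iota 0%N 0%N il) index_uniq ?size_iota ?iota_uniq.
Qed.

Lemma spread_support x : spread x <> gone -> exists2 i, (i < length l)%N & x = pos i.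
Proof.
rewrite /spread; case: (boolP ((x : nat) \in pows)) => [/mapP [i]|].
  rewrite mem_iota add0n => il xi _; exists i => //.
  by apply: val_inj; rewrite /= pos_nat.
(* Away from the listed powers [index] returns at least [length l], where [nth] takes its default
   [gone]. *)
by rewrite -index_mem size_map size_iota -leqNgt => /leP h [] //; exact: nth_overflow.
Qed.

(** The bound [2^(length l + 1) <= n] keeps sums of two positions below [n], so equality in ['Z_n]
    is equality of natural numbers. *)
Lemma pos_sidon a b i j : (a < length l)%N -> (b < length l)%N ->
  (i < length l)%N -> (j < length l)%N ->
  pos a + pos j = pos b + pos i -> a = i \/ i = j.
Proof.
move=> al bl il jl; rewrite /pos -!natrD => /(f_equal (fun x : 'Z_n => x : nat)).
have lt u v : (u < length l)%N -> (v < length l)%N -> (expn 2 u + expn 2 v < n)%N.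
  move=> ul vl; apply: leq_trans nl; rewrite expnS mul2n -addnn.
  by rewrite -addSn leq_add // ?ltn_exp2l // leq_exp2l // ltnW.
rewrite !val_Zp_nat // !modn_small ?lt // => /pow2_sidon; lia.
Qed.

Let t : Wreath G n := shift G n 1.
Let b : Wreath G n := base G n spread.
Definition two_gen : Wreath G n -> Prop := gen (fun x => x = t \/ x = b).

Lemma two_gen_shift a : two_gen (shift G n a).
Proof.
rewrite -[a]natr_Zp; elim: (nat_of_ord a) => [|k IH]; first exact: gen_one.
by rewrite -addn1 natrD -shift_mul; apply: gen_mul => //; apply: gen_base; left.
Qed.

(** This conjugate of [b] by a shift carries the [i]-th generator at coordinate 0. *)
Lemma two_gen_spread i : two_gen (base G n (fun x => spread (x + pos i))).
Proof.
have -> : base G n (fun x => spread (x + pos i)) =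
    gmul (gmul (shift G n (- pos i)) (base G n spread)) (shift G n (- - pos i)).
  by rewrite shift_conj; congr base; apply: functional_extensionality => x; rewrite opprK.
by do 2![apply: gen_mul; last exact: two_gen_shift || by apply: gen_base; right];
  exact: two_gen_shift.
Qed.

(** If both factors are nontrivial at [x], then [x + pos i = pos a] and [x + pos j = pos c]; by the
    Sidon property either [a = i], so that [x = 0], or [i = j] and the two entries coincide. *)
Lemma comm_spread i j : (i < length l)%N -> (j < length l)%N ->
  commg (base G n (fun x => spread (x + pos i))) (base G n (fun x => spread (x + pos j))) =
  delta G n 0 (commg (List.nth i l gone) (List.nth j l gone)).
Proof.
move=> il jl; rewrite base_comm; congr base; apply: functional_extensionality => x.
case: (eqVneq x 0) => [->|x0]; first by rewrite !add0r !spread_pos.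
case: (excluded_middle_informative (spread (x + pos i) = gone)) => [->|].
  by rewrite /commg !gE.
case/spread_support => a al ea.
case: (excluded_middle_informative (spread (x + pos j) = gone)) => [->|].
  by rewrite /commg !gE.
case/spread_support => c cl ec.
have e : pos a + pos j = pos c + pos i by rewrite -ea -ec addrAC.
have [ai|ij] := pos_sidon a c i j al cl il jl e; last by rewrite ij /commg !gE.
by move: x0; rewrite -(addrK (pos i) x) ea ai subrr eqxx.
Qed.

(** Only the coordinate 0 of the conjugating element meets the support of [delta 0 x], and its entry
    there is the [i]-th generator. Thus [two_gen] sees conjugation by generators inside coordinate
    0. *)
Lemma delta_conj_spread i x : (i < length l)%N ->
  delta G n 0 (gmul (gmul (ginv (List.nth i l gone)) x) (List.nth i l gone)) =
  gmul (gmul (ginv (base G n (fun x => spread (x + pos i)))) (delta G n 0 x))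
    (base G n (fun x => spread (x + pos i))).
Proof.
move=> il; rewrite base_inv /delta !base_mul; congr base.
apply: functional_extensionality => y; case: eqP => [->|_]; last by rewrite gmulg1 gmulVg.
by rewrite add0r spread_pos.
Qed.

Lemma delta_conj_spread' i x : (i < length l)%N ->
  delta G n 0 (gmul (gmul (List.nth i l gone) x) (ginv (List.nth i l gone))) =
  gmul (gmul (base G n (fun x => spread (x + pos i))) (delta G n 0 x))
    (ginv (base G n (fun x => spread (x + pos i)))).
Proof.
move=> il; rewrite base_inv /delta !base_mul; congr base.
apply: functional_extensionality => y; case: eqP => [->|_]; last by rewrite gmulg1 gmulgV.
by rewrite add0r spread_pos.
Qed.

Lemma two_gen_derived i x : derived (@allG G) x -> two_gen (delta G n i x).
Proof.
have [H1 [HM HV]] := gen_subgroup (fun x => x = t \/ x = b).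
have idx g : In g l -> exists2 k, (k < length l)%N & List.nth k l gone = g.
  by move=> /(In_nth _ _ gone) [k [/ltP kl e]]; exists k.
move=> dx; rewrite -delta_shift; apply: (HM); last exact: two_gen_shift.
apply: (HM); first exact: two_gen_shift.
apply: (derived_sub_of_generators G l (fun x => two_gen (delta G n 0 x)) hl) dx.
- split; first by rewrite delta1.
  by split=> [y z hy hz|y hy]; rewrite ?deltaM ?deltaV; [apply: (HM)|apply: (HV)].
- move=> g y /idx [k kl <-] hy; rewrite delta_conj_spread //.
  by apply: (HM); [apply: (HM) => //; apply: (HV)|]; exact: two_gen_spread.
- move=> g y /idx [k kl <-] hy; rewrite delta_conj_spread' //.
  by apply: (HM); [apply: (HM) => //|apply: (HV)]; exact: two_gen_spread.
move=> g h /idx [k kl <-] /idx [m ml <-]; rewrite -comm_spread //.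
by rewrite /commg; do !apply: (HM); try apply: (HV); exact: two_gen_spread.
Qed.

End TwoGenerators.

(** * Iterated wreath products as extensions by finite metabelian groups *)

Section IteratedWreath.
Variables (G : AbsGroup) (p n : nat).
Local Notation L := (Wreath (Wreath G p) n).

(** The kernel of the projection of [L] onto the wreath product of ['Z_p] by ['Z_n], which is finite
    and metabelian. *)
Definition double_base (z : L) := z.2 = 0 /\ forall i, (z.1 i).2 = 0.

Lemma double_base_subgroup : subgroup double_base.
Proof.
split; first by [].
split=> [x y [x2 hx] [y2 hy]|x [x2 hx]].
  by split=> [|i] /=; [rewrite x2 y2 addr0|rewrite hx hy addr0].
by split=> [|i] /=; [rewrite x2 oppr0|rewrite hx oppr0].
Qed.

Lemma double_base_normal (l x : L) : double_base x -> double_base (gmul (gmul (ginv l) x) l).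
Proof.
move=> [x2 hx]; split=> [|i] /=; first by rewrite x2 addr0 addNr.
by rewrite x2 hx !addr0 opprK addNr.
Qed.

Definition double_embed (x : DirectPower G #|{: 'Z_n * 'Z_p}|) : L :=
  base _ n (fun i => base G p (fun j => x (enum_rank (i, j)))).

Lemma double_embedM x y : double_embed (gmul x y) = gmul (double_embed x) (double_embed y).
Proof.
rewrite /double_embed base_mul; congr base; apply: functional_extensionality => i.
by rewrite base_mul.
Qed.

Lemma double_embed_inj x y : double_embed x = double_embed y -> x = y.
Proof.
move=> e; apply: functional_extensionality => k; rewrite -(enum_valK k).
case: (enum_val k) => i j.
by have := f_equal (fun z : L => (z.1 i).1 j) e.
Qed.

Lemma double_baseP z : double_base z <-> exists x, z = double_embed x.
Proof.
split=> [[z2 hz]|[x ->]]; last by [].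
exists (fun k => (z.1 (enum_val k).1).1 (enum_val k).2).
apply: wreath_eq => [i|] //; apply: wreath_eq => [j|] /=; last exact: hz.
by rewrite enum_rankK.
Qed.

Lemma double_base_finite_index :
  exists T : list L, forall x, exists t, In t T /\ double_base (gmul (ginv t) x).
Proof.
(* The representatives are the elements all of whose entries in [G] are trivial. *)
exists (List.map (fun ca : {ffun 'Z_n -> 'Z_p} * 'Z_n =>
    ((fun i => shift G p (ca.1 i)), ca.2) : L)
  (enum {: {ffun 'Z_n -> 'Z_p} * 'Z_n})).
move=> [f a]; exists ((fun i => shift G p ((f i).2)), a); split.
  apply/in_map_iff; exists ([ffun i => (f i).2], a); split; last exact: In_enum.
  by apply: wreath_eq => [i|] //=; rewrite ffunE.
by split=> [|i] /=; rewrite ?opprK addNr.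
Qed.

(** A first commutator kills the outer shift, as ['Z_n] is abelian; between elements without outer
    shift, a second one kills the inner shifts coordinate by coordinate, as ['Z_p] is abelian. *)
Lemma double_base_metabelian x : derived (derived (@allG L)) x -> double_base x.
Proof.
have top (y : L) : derived (@allG L) y -> y.2 = 0.
  move=> dy; apply: (gen_min _ (fun y : L => y.2 = 0) _ _ _ dy).
    split; first by [].
    by split=> [u v /= -> ->|u /= ->]; rewrite ?addr0 ?oppr0.
  by move=> _ [u [v [_ [_ ->]]]] /=; rewrite -opprD addNr.
move=> dx; apply: gen_min dx; first exact: double_base_subgroup.
move=> _ [u [v [/top u2 [/top v2 ->]]]]; split=> [|i] /=.
  by rewrite u2 v2 !(oppr0, addr0).
rewrite u2 v2 !(oppr0, addr0).
by rewrite -opprD addNr.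
Qed.

Lemma double_base_extension : ext_power_by_fin_metabelian G #|{: 'Z_n * 'Z_p}| double_base.
Proof.
split; last by split; [exact: double_base_normal|
  split; [exact: double_base_finite_index|exact: double_base_metabelian]].
exists double_embed; split; first exact: double_embedM.
by split; [exact: double_embed_inj|exact: double_baseP].
Qed.

End IteratedWreath.

(** Common source of (a) and (b): it is applied to [G] for the former and to a wreath product over
    [G] for the latter. *)
Lemma two_generated_wreath (G : AbsGroup) : finitely_generated G ->
  exists N : nat, forall n : nat, (N <= n)%coq_nat -> (1 < n)%coq_nat ->
    exists H : Wreath G n -> Prop, [/\ subgroup H, two_generated H,
      forall i x, derived (@allG G) x -> H (delta G n i x)
      & property_T (@allG G) -> property_T H].
Proof.
move=> fg; have [l hl] := fg; exists (expn 2 (length l).+1) => n /leP nl /ltP n1.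
have hd := two_gen_derived G l n hl n1 nl.
exists (two_gen G l n); split=> //; first exact: gen_subgroup.
  by exists (shift G n 1), (base G n (spread G l n)) => z.
move=> T; have [TD fi] := property_T_derived G fg T.
apply: (wreath_property_T G n _ _ (@derived_subgroup G) fi TD) => //.
exact: gen_subgroup.
Qed.

Lemma property_T_wreath (G : AbsGroup) n : property_T (@allG G) -> property_T (@allG (Wreath G n)).
Proof.
move=> T; apply: (wreath_property_T G n (@allG G)) => //.
by exists (cons gone nil) => x; exists gone; split=> //; left.
Qed.

Theorem theorem4p4 (G : AbsGroup) (hG : finitely_generated G) :
  (* (a) + (c) for (a) *)
  (exists N : nat, forall n : nat, (N <= n)%coq_nat -> (1 < n)%coq_nat ->
     exists H : Wreath G n -> Prop,
       two_generated H /\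
       embeds_into (derived (@allG G)) H /\
       (forall w, derived (@wr_base G n) w -> H w) /\
       (property_T (@allG G) -> property_T H)) /\
  (* (b) + (c) for (b) *)
  (torsion G ->
     exists (n : nat) (L : AbsGroup) (NL : L -> Prop) (H : L -> Prop),
       ext_power_by_fin_metabelian G n NL /\
       two_generated H /\
       embeds_into (@allG G) H /\
       (property_T (@allG G) -> property_T H)).
Proof.
split.
  have [N hN] := two_generated_wreath G hG; exists N => n Nn n1.
  have [H [sH H2 hd HT]] := hN n Nn n1; exists H; split=> //.
  split; last split=> //.
    exists (delta G n 0); split; first by move=> *; exact: deltaM.
    by split=> [x y _ _|x]; [exact: delta_inj|exact: hd].
  by move=> w /derived_base [-> hw]; exact: base_subgroup sH hd hw.
move=> tG.
have [[_ [M [M0 hM]]]|[chi /(torsion_real_char G chi tG) //]] := finite_or_real_char G hG.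
(* Doubling [M] keeps it an exponent modulo commutators and makes it exceed 1 even when [M = 1], as
   [diagonal_in_derived] demands. *)
have p1 : (1 < M + M)%N by rewrite -addn1 leq_add.
have [N hN] := two_generated_wreath _ (wreath_finitely_generated G (M + M)%N hG).
have [H [sH H2 hd HT]] := hN (N + 2)%coq_nat (Nat.le_add_r _ _) ltac:(lia).
exists #|{: 'Z_(N + 2)%coq_nat * 'Z_(M + M)}|, (Wreath (Wreath G (M + M)%N) (N + 2)%coq_nat).
exists (double_base G (M + M)%N (N + 2)%coq_nat), H; split; first exact: double_base_extension.
split=> //; split; last by move=> T; apply: HT; exact: property_T_wreath.
(* [G] sits diagonally in the inner base group, inside the derived subgroup of the inner wreath
   product, whose copy in the outer coordinate 0 is contained in [H]. *)
exists (fun x => delta _ _ 0 (base G (M + M)%N (fun _ => x))); split; [|split].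
- by move=> x y _ _; rewrite -deltaM base_mul.
- by move=> x y _ _ /delta_inj /(f_equal (fun w : Wreath G (M + M)%N => w.1 0)).
move=> x _; apply: hd; apply: diagonal_in_derived => //.
rewrite gpowD; exact: gen_mul (hM x) (hM x).
Qed.
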